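(* Let $\alpha\in(0,1)$, $\delta\in(0,1-\alpha)$, $1\le k\le p$, and set $$\rho^2_{k,p,n}=\Big(1\wedge\frac{\log(1+8(1-\alpha-\delta)^2)}{2}\Big)\frac kn\log\Big(1+\frac{p}{k^2}+\sqrt{\frac{2p}{k^2}}\Big).$$ Suppose the covariance matrix of $X$ is the identity $I$ and $\mathrm{var}(Y)>0$ is known. Then for all $\rho<\rho_{k,p,n}$, $$\beta_I\Big(\Big\{\theta\in\Theta[k,p]:\frac{\|\theta\|^2}{\mathrm{var}(Y)-\|\theta\|^2}=\rho^2\Big\}\Big)>\delta.$$ Moreover, if $\alpha+\delta\le0.53$, then $\rho^2_{k,p,n}\ge\frac{k}{2n}\log\Big(1+\frac{p}{k^2}\vee\sqrt{\frac{p}{k^2}}\Big)$.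
   Context: Model: $Y=\sum_{i=1}^p\theta_iX_i+\epsilon$, where $\theta\in\mathbb R^p$, $X=(X_1,\dots,X_p)$ is a centered Gaussian vector with non-singular covariance matrix $\Sigma$, and $\epsilon$ is a centered Gaussian variable independent of $X$. $\|\theta\|^2:=\theta^T\Sigma\theta$. One observes $n$ i.i.d. copies of $(Y,X)$ giving $(\mathbf Y,\mathbf X)$. For given $\Sigma$ and a fixed value of $\mathrm{var}(Y)$, $\mathbb P_\theta$ is the law of $(\mathbf Y,\mathbf X)$ when the parameter is $\theta$ (so $\mathrm{var}(\epsilon)=\mathrm{var}(Y)-\|\theta\|^2$). For $\Theta\subset\mathbb R^p$, $\beta_\Sigma(\Theta)=\inf_{\psi_\alpha}\sup_{\theta\in\Theta}\mathbb P_\theta(\psi_\alpha=0)$, the infimum over all tests $\psi_\alpha\in\{0,1\}$ of the hypothesis $\theta=0$ with $\mathbb P_0(\psi_\alpha=1)\le\alpha$. $\Theta[k,p]$ is the set of $\theta\in\mathbb R^p$ with at most $k$ nonzero coordinates. *)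

(* Defs.v *)
From HB Require Import structures.
From mathcomp Require Import all_boot all_order all_algebra.
From mathcomp Require Import all_classical all_reals all_analysis.
Set Implicit Arguments.
Unset Strict Implicit.
Unset Printing Implicit Defensive.
Import Order.TTheory GRing.Theory Num.Theory.
Local Open Scope classical_set_scope.
Local Open Scope ring_scope.

(* Mutual independence of a finite family of real random variables:
   the product rule for every family of Borel sets (taking B i = setT
   recovers every subfamily). *)
Definition mutually_independent {d} {Omega : measurableType d} {R : realType}
    (P : probability Omega R) (I : finType) (G : I -> Omega -> R) : Prop :=
  forall B : I -> set R, (forall i, measurable (B i)) ->
    P (\bigcap_(i in [set: I]) (G i @^-1` B i)) =
    (\prod_(i : I) P (G i @^-1` B i))%E.

Definition std_gaussian {d} {Omega : measurableType d} {R : realType}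
    (P : probability Omega R) (G : Omega -> R) : Prop :=
  measurable_fun [set: Omega] G /\
  forall B : set R, measurable B -> P (G @^-1` B) = normal_prob 0 1 B.

Definition Theta_kp {R : realType} (k p : nat) : set ('I_p -> R) :=
  [set theta : 'I_p -> R | (#|[set j | theta j != 0%R]| <= k)%N].

(* ||theta||^2 = theta^T Sigma theta with Sigma = I. *)
Definition sqnormI {R : realType} (p : nat) (theta : 'I_p -> R) : R :=
  \sum_(j < p) theta j ^+ 2.

(* Sample space of the observations (Y, X): n responses and n covariate
   vectors in R^p, with the product (tuple) sigma-algebra. *)
Definition data_space (R : realType) (n p : nat) :=
  (n.-tuple R * n.-tuple (p.-tuple R))%type.

(* Realization of the n i.i.d. observations under parameter theta, for
   Sigma = I and var(Y) = v:  X_ij = Z_ij, Y_i = sum_j theta_j Z_ij + eps_i,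
   eps_i = sqrt(v - ||theta||^2) W_i, with Z, W i.i.d. N(0,1). *)
Definition observations {d} {Omega : measurableType d} {R : realType}
    (n p : nat) (v : R) (Z : 'I_n -> 'I_p -> Omega -> R) (W : 'I_n -> Omega -> R)
    (theta : 'I_p -> R) (w : Omega) : data_space R n p :=
  ([tuple (\sum_(j < p) theta j * Z i j w)
          + Num.sqrt (v - sqnormI theta) * W i w | i < n],
   [tuple [tuple Z i j w | j < p] | i < n]).

Definition Ptheta {d} {Omega : measurableType d} {R : realType}
    (P : probability Omega R) (n p : nat) (v : R)
    (Z : 'I_n -> 'I_p -> Omega -> R) (W : 'I_n -> Omega -> R)
    (theta : 'I_p -> R) (A : set (data_space R n p)) : \bar R :=
  P (observations v Z W theta @^-1` A).

(* beta_I(Theta): infimum over level-alpha tests (a test psi in {0,1} is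
   identified with its measurable rejection region A = {psi = 1}) of the
   maximal type II error sup_{theta in Theta} P_theta(psi = 0). *)
Definition beta_I {d} {Omega : measurableType d} {R : realType}
    (P : probability Omega R) (n p : nat) (v alpha : R)
    (Z : 'I_n -> 'I_p -> Omega -> R) (W : 'I_n -> Omega -> R)
    (Theta : set ('I_p -> R)) : \bar R :=
  ereal_inf [set ereal_sup [set Ptheta P v Z W theta (~` A) | theta in Theta]
            | A in [set A : set (data_space R n p) | measurable A /\
                     (Ptheta P v Z W (fun=> 0%R) A <= alpha%:E)%E]].

Definition rho2_kpn {R : realType} (alpha delta : R) (k p n : nat) : R :=
  Num.min 1 (ln (1 + 8 * (1 - alpha - delta) ^+ 2) / 2)
  * (k%:R / n%:R) * ln (1 + p%:R / k%:R ^+ 2 + Num.sqrt (2 * p%:R / k%:R ^+ 2)).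

(* Main.v *)
Require Import Defs.
From HB Require Import structures.
From mathcomp Require Import all_boot all_order all_algebra.
From mathcomp Require Import all_classical all_reals all_analysis.
From mathcomp Require Import measurable_realfun.
From mathcomp Require Import ring lra.
Import Order.TTheory GRing.Theory Num.Theory.
Set Implicit Arguments.
Unset Strict Implicit.
Unset Printing Implicit Defensive.
Local Open Scope classical_set_scope.
Local Open Scope ring_scope.

(** The maximal type II error is bounded below by its average over a prior
    drawing a uniform support of size k and uniform signs, all coefficients
    having equal modulus. Writing u = theta / sqrt v and L_u for the likelihood
    ratio against theta = 0, Gaussian integration gives
    E_0 (L_u L_u') = (1 - <u, u'>)^-n, so the second moment V of the averaged
    likelihood ratio is E (1 - r Z / k)^-n with r = rho^2 / (1 + rho^2) and Z a
    sum of independent signs over the intersection of two random supports.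
    Pairing Z with -Z yields V <= (1 + E exp (a |Z|)) / 2, a = n rho^2 / k.
    If exp a0 = 1 + x + sqrt (2 x) with x = p / k^2, then cosh a0 <= 1 + x and
    E exp (a0 |Z|) <= 2 e; since a <= c a0, concavity gives
    V <= (1 + (2 e)^c) / 2 < (1 + exp (2 c)) / 2 <= 1 + 4 (1 - alpha - delta)^2.

    Since the independence hypothesis only speaks about products of Borel sets,
    all Gaussian integrals are reduced to one-dimensional ones by resampling a
    single coordinate at a time. *)

(** * Product space over a finite index set *)

Definition coords (R : realType) (I : finType) := I -> R.

Definition rectangle (R : realType) (I : finType) (B : I -> set R) :
  set (coords R I) := [set t | forall i, B i (t i)].

Definition rectangles (R : realType) (I : finType) : set (set (coords R I)) :=
  [set A | exists2 B : I -> set R, (forall i, measurable (B i)) &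
    A = rectangle B].

HB.instance Definition _ (R : realType) (I : finType) :=
  gen_eqMixin (coords R I).
HB.instance Definition _ (R : realType) (I : finType) :=
  gen_choiceMixin (coords R I).
HB.instance Definition _ (R : realType) (I : finType) :=
  isPointed.Build (coords R I) (fun=> 0).
(** The sigma-algebra is generated by the boxes with Borel sides. These are stable under
    intersection, so a probability here is determined by the product rule that independence
    provides. *)
HB.instance Definition _ (R : realType) (I : finType) :=
  @isMeasurable.Build (sigma_display (@rectangles R I)) (coords R I)
    <<s @rectangles R I >> (@sigma_algebra0 _ setT (@rectangles R I))
    (@sigma_algebraC (coords R I) (@rectangles R I))
    (@sigma_algebra_bigcup _ setT (@rectangles R I)).

Definition upd (R : realType) (I : finType) (t : coords R I) (i : I) (x : R) :
  coords R I := fun j => if j == i then x else t j.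

Section coords.
Context (R : realType) (I : finType).
Implicit Types (t : coords R I) (i j : I).

Lemma setI_closed_rectangles : setI_closed (@rectangles R I).
Proof.
move=> _ _ [B mB ->] [C mC ->]; exists (fun i => B i `&` C i).
  by move=> i; exact: measurableI.
by apply/seteqP; split => [t [Bt Ct] i|t BCt]; [split|split=> i; case: (BCt i)].
Qed.

Lemma measurable_rectangle (B : I -> set R) :
  (forall i, measurable (B i)) -> measurable (rectangle B).
Proof. by move=> mB; apply: sub_sigma_algebra; exists B. Qed.

Lemma measurable_fun_coords d (T : measurableType d) (f : T -> coords R I) :
  (forall i, measurable_fun setT (fun x => f x i)) -> measurable_fun setT f.
Proof.
move=> mf; apply: (@measurability _ _ _ _ setT f (@rectangles R I)) => //.
move=> _ [_ [B mB ->] <-]; rewrite setTI.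
rewrite [X in measurable X](_ : _ =
    \bigcap_(i in [set: I]) ((fun x => f x i) @^-1` B i)); last first.
  by apply/seteqP; split => [x Bx i _|x Bx i]; [exact: Bx|exact: Bx].
apply: fin_bigcap_measurable => [|i _]; first exact: finite_finset.
by rewrite -[X in measurable X]setTI; exact: mf.
Qed.

Lemma measurable_coord i : measurable_fun setT (fun t => t i).
Proof.
move=> _ B mB; rewrite setTI.
rewrite [X in measurable X](_ : _ =
    rectangle (fun j => if j == i then B else setT)).
  by apply: measurable_rectangle => j; case: ifP.
apply/seteqP; split => [t Bt j|t /(_ i)]; last by rewrite eqxx.
by have [->|] := eqVneq j i.
Qed.

Lemma measurable_upd i :
  measurable_fun setT (fun tx : coords R I * R => upd tx.1 i tx.2).
Proof.
apply: measurable_fun_coords => j; rewrite /upd; case: (j == i) => /=.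
  exact: measurable_snd.
exact: (measurableT_comp (measurable_coord j)).
Qed.

End coords.

(** * Resampling one coordinate of a Gaussian vector *)

Section resampling.
Context (R : realType) (I : finType).
Variable Q : probability (coords R I) R.
Hypothesis Q_rect : forall B : I -> set R, (forall i, measurable (B i)) ->
  Q (rectangle B) = (\prod_(i : I) normal_prob 0 1 (B i))%E.
Local Notation gauss := (@normal_prob R 0 1).

(** Two finite measures that agree on the pi-system of rectangles coincide. On a rectangle, the
    redrawn coordinate contributes the same Gaussian factor as the original one. *)
Lemma resample_set (i : I) (A : set (coords R I)) : measurable A ->
  (Q \x gauss)%E ((fun tx : coords R I * R => upd tx.1 i tx.2) @^-1` A) = Q A.
Proof.
move=> mA.
apply: (measure_unique (@rectangles R I) (fun=> setT)
    _ _ _ _ (pushforward (Q \x gauss)%E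
      (fun tx : coords R I * R => upd tx.1 i tx.2)) Q) => //.
- exact: setI_closed_rectangles.
- by move=> _; exists (fun=> setT) => //; apply/seteqP; split.
- by apply/seteqP; split => // t _; exists 0%N.
- exact: measurable_upd.
- move=> mupd _ [B mB ->]; rewrite /= /pushforward.
  (* The old value of coordinate [i] is overwritten, so it is unconstrained in the preimage. *)
  pose B' j := if j == i then setT else B j.
  have mB' j : measurable (B' j) by rewrite /B'; case: ifP.
  transitivity ((Q \x gauss)%E (rectangle B' `*` B i)).
    congr (product_measure1 _ _ _).
    apply/seteqP; split => [[t x] /= Bt|[t x] [/= B't Bx] j].
      split=> [j|]; last by have := Bt i; rewrite /upd eqxx.
      by rewrite /B'; case: ifPn => // ji; have := Bt j; rewrite /upd (negbTE ji).
    by have := B't j; rewrite /B' /upd; case: (eqVneq j i) => [->|].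
  rewrite product_measure1E; [|exact: measurable_rectangle|exact: mB].
  transitivity ((\prod_j gauss (B' j)) * gauss (B i))%E.
    by congr (_ * _)%E; exact: Q_rect.
  rewrite (Q_rect mB) (bigD1 i)//= [in RHS](bigD1 i)//= muleC.
  rewrite /B' eqxx probability_setT mul1e; congr (_ * _)%E.
  by apply: eq_bigr => j /negbTE ->.
- move=> mupd _; apply: (@le_lt_trans _ _ 1%E); last exact: ltry.
  apply: (@le_trans _ _ (Q setT * gauss setT)%E).
    rewrite -(product_measure1E Q gauss measurableT measurableT) setXTT.
    exact: lexx.
  rewrite [X in (X * _)%E](probability_setT Q).
  by rewrite [X in (_ * X)%E](probability_setT gauss) mule1.
Qed.

Lemma resample (i : I) (f : coords R I -> \bar R) :
  measurable_fun setT f -> (forall t, 0 <= f t)%E ->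
  (\int[Q]_t f t = \int[Q]_t \int[gauss]_x f (upd t i x))%E.
Proof.
move=> mf f0.
transitivity (\int[pushforward (Q \x gauss)%E
    (fun tx : coords R I * R => upd tx.1 i tx.2)]_t f t)%E.
  apply: eq_measure_integral => [|mupd A mA _]; first exact: measurable_upd.
  exact/esym/resample_set.
rewrite ge0_integral_pushforward//; last exact: measurable_upd.
rewrite preimage_setT fubini_tonelli1//=.
by apply: measurableT_comp => //; exact: measurable_upd.
Qed.

End resampling.

(** * Gaussian integrals through densities and affine changes of variable *)

Section gauss.
Context {R : realType}.
Local Notation leb := (@lebesgue_measure R).
Import HBNNSimple.

(** For indicators this is the definition of the measure; linearity extends it to simple functions
    and monotone convergence to all nonnegative measurable ones. *)
Lemma ge0_integral_normal_prob (m s : R) (f : R -> \bar R) :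
  measurable_fun setT f -> (forall x, 0 <= f x)%E ->
  (\int[normal_prob m s]_x f x = \int[leb]_x (f x * (normal_pdf m s x)%:E))%E.
Proof.
move=> mf f0.
have mpdf : measurable_fun setT (fun x : R => (normal_pdf m s x)%:E).
  by apply/measurable_EFinP; exact: measurable_normal_pdf.
have indicE_ (A : set R) : measurable A ->
    (\int[normal_prob m s]_x (\1_A x)%:E =
     \int[leb]_x ((\1_A x)%:E * (normal_pdf m s x)%:E))%E.
  move=> mA; transitivity (normal_prob m s A).
    by rewrite integral_indic// setIT.
  rewrite /normal_prob [LHS]integral_mkcond; apply: eq_integral => x _.
  by rewrite patchE indicE; case: ifP => xA; rewrite ?mul1e ?mul0e.
pose f_ := @nnsfun_approx _ (measurableTypeR R) _ _ measurableT f mf.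
transitivity (limn (fun n => \int[normal_prob m s]_x (f_ n x)%:E))%E.
  rewrite -monotone_convergence//.
  - apply: eq_integral => x _; apply/esym/cvg_lim => //.
    by apply: cvg_nnsfun_approx.
  - by move=> n; exact/measurable_EFinP/measurable_funP.
  - by move=> n x _; rewrite lee_fin.
  - by move=> x _ a b ab; rewrite lee_fin; exact/lefP/nd_nnsfun_approx.
transitivity (limn (fun n =>
    \int[leb]_x ((f_ n x)%:E * (normal_pdf m s x)%:E)))%E; last first.
  rewrite -monotone_convergence//.
  - apply: eq_integral => x _.
    apply/cvg_lim => //; apply: cvgeZr => //.
    by apply: cvg_nnsfun_approx.
  - by move=> n; apply: emeasurable_funM => //; exact/measurable_EFinP/measurable_funP.
  - by move=> n x _; rewrite -EFinM lee_fin mulr_ge0// normal_pdf_ge0.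
  - move=> x _ a b ab; apply: lee_wpmul2r.
      by rewrite lee_fin normal_pdf_ge0.
    by rewrite lee_fin; exact/lefP/nd_nnsfun_approx.
congr (limn _); apply/funext => n.
under eq_integral do rewrite fimfunE -fsumEFin//.
under [RHS]eq_integral => x _.
  rewrite fimfunE -fsumEFin// ge0_mule_fsuml; last first.
    by move=> r; rewrite nnfun_muleindic_ge0.
  over.
rewrite !ge0_integral_fsum//; last 4 first.
- move=> r; apply: emeasurable_funM => //.
  by apply/measurable_EFinP/measurable_funM.
- by move=> r x _; rewrite mule_ge0 ?nnfun_muleindic_ge0 ?lee_fin ?normal_pdf_ge0.
- by move=> r; apply/measurable_EFinP/measurable_funM.
- by move=> r x _; rewrite nnfun_muleindic_ge0.
apply: eq_fsbigr => r _.
have mr : measurable (f_ n @^-1` [set r]) by [].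
(* A nonnegative simple function never takes a negative value, so that preimage is empty. *)
have [r0|r0] := leP 0 r; last first.
  rewrite preimage_nnfun0//.
  rewrite !integral0_eq// => x _; rewrite indic0 mulr0 ?mul0e//.
under eq_integral do rewrite EFinM.
under [RHS]eq_integral do rewrite EFinM -muleA.
rewrite !ge0_integralZl//.
- by rewrite indicE_.
- apply: emeasurable_funM => //; exact/measurable_EFinP/measurable_indic.
- by move=> x _; rewrite mule_ge0 ?lee_fin ?normal_pdf_ge0.
- exact/measurable_EFinP/measurable_indic.
Qed.

(** The right-hand side is a measure in [A] that gives half-open intervals their length, hence it is
    Lebesgue measure by uniqueness. *)
Lemma lebesgue_measure_affine (a b : R) (b0 : 0 < b) (A : set R) :
  measurable A ->
  leb A = (b%:E * leb ((fun x => (a + b * x)%R) @^-1` A))%E.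
Proof.
have mphi : measurable_fun [set: measurableTypeR R]
    (fun x : measurableTypeR R => a + b * x : measurableTypeR R).
  by apply: measurable_funD => //; exact: measurable_funM.
move=> mA; apply: (lebesgue_measure_unique (mu := mscale (NngNum (ltW b0))
  (pushforward leb
    (fun x : measurableTypeR R => a + b * x : measurableTypeR R)))) => //.
move=> _ [[x y]] _ <-.
rewrite /= /mscale/= /pushforward.
rewrite [X in (_ * leb X)%E](_ : _ = `](x - a) / b, (y - a) / b]%classic); last first.
  apply/seteqP; split => z /=; rewrite !in_itv/= ltr_pdivrMr// ler_pdivlMr//;
    by rewrite ltrBlDl lerBrDl mulrC.
rewrite !lebesgue_measure_itv/= !lte_fin ltr_pM2r ?invr_gt0// ltrD2r.
case: ifPn => _; last by rewrite mule0.
by rewrite -!EFinB -EFinM; congr EFin; field; rewrite gt_eqF.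
Qed.

Lemma ge0_integral_normal_affine (a b : R) (f : R -> \bar R) : 0 < b ->
  measurable_fun setT f -> (forall x, 0 <= f x)%E ->
  (\int[normal_prob 0 1]_x f (a + b * x)%R =
   \int[normal_prob a b]_x f x)%E.
Proof.
move=> b0 mf f0.
have mphi : measurable_fun [set: measurableTypeR R]
    (fun x : measurableTypeR R => a + b * x : measurableTypeR R).
  by apply: measurable_funD => //; exact: measurable_funM.
have mpdf : measurable_fun setT (fun x : R => (normal_pdf a b x)%:E).
  by apply/measurable_EFinP; exact: measurable_normal_pdf.
have mfphi : measurable_fun setT (fun x : R => f (a + b * x)%R).
  exact: (measurableT_comp mf mphi).
rewrite (ge0_integral_normal_prob 0 1 mfphi (fun x => f0 _)).
rewrite (ge0_integral_normal_prob a b mf f0).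
rewrite [RHS](eq_measure_integral (mscale (NngNum (ltW b0))
  (pushforward leb
    (fun x : measurableTypeR R => a + b * x : measurableTypeR R)))); first last.
- by move=> A mA _; exact: (lebesgue_measure_affine a b0 mA).
rewrite ge0_integral_mscale//; first last.
- by move=> x _; rewrite mule_ge0 ?lee_fin ?normal_pdf_ge0.
- exact: emeasurable_funM.
rewrite ge0_integral_pushforward//; first last.
- by move=> x _; rewrite mule_ge0 ?lee_fin ?normal_pdf_ge0.
- exact: emeasurable_funM.
rewrite preimage_setT -ge0_integralZl//; first last.
- by move=> x _; rewrite mule_ge0 ?lee_fin ?normal_pdf_ge0.
- apply: (measurableT_comp _ mphi); exact: emeasurable_funM.
apply: eq_integral => x _ /=.
rewrite muleCA; congr (_ * _)%E; rewrite -EFinM; congr EFin.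
rewrite !normal_pdfE ?gt_eqF// /normal_peak /normal_fun.
rewrite expr1n mul1r subr0 addrAC subrr add0r mulrA; congr (_ * _).
  rewrite -mulrnAr sqrtrM ?sqr_ge0// sqrtr_sqr gtr0_norm// invfM mulrA.
  by rewrite divff ?mul1r// gt_eqF.
congr expR; rewrite exprMn; field.
by rewrite gt_eqF.
Qed.

End gauss.

(** * One-dimensional Gaussian integrals of kernels and likelihood ratios *)

Section kernel.
Context {R : realType}.
Local Notation gauss := (@normal_prob R 0 1).

(** Common form of the integrals evaluated by completing the square: the integrand is a constant
    times another normal density. *)
Lemma integral_gauss_pdf (f : R -> R) (C m s : R) :
  measurable_fun setT f -> (forall x, 0 <= f x) ->
  (forall x, f x * normal_pdf 0 1 x = C * normal_pdf m s x) -> 0 <= C ->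
  (\int[gauss]_x (f x)%:E = C%:E)%E.
Proof.
move=> mf f0 fE C0.
rewrite ge0_integral_normal_prob//; last exact/measurable_EFinP.
under eq_integral do rewrite -EFinM fE EFinM.
rewrite ge0_integralZl//.
- by rewrite integral_normal_pdf mule1.
- by apply/measurable_EFinP; exact: measurable_normal_pdf.
- by move=> x _; rewrite lee_fin normal_pdf_ge0.
Qed.

(** 2 pi times the centered Gaussian density with covariance [[a, b], [b, c]]:
    integrating out a Gaussian in direction (t1, t2) adds a rank-one term to the
    covariance. *)
Definition kern (a b c w1 w2 : R) :=
  (Num.sqrt (a * c - b ^+ 2))^-1 *
  expR (- (c * w1 ^+ 2 - 2 * b * w1 * w2 + a * w2 ^+ 2) / (2 * (a * c - b ^+ 2))).

Lemma kern_ge0 a b c w1 w2 : 0 <= kern a b c w1 w2.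
Proof. by rewrite mulr_ge0 ?invr_ge0 ?sqrtr_ge0 ?expR_ge0. Qed.

Lemma measurable_kern d (T : measurableType d) (a b c : R) (w1 w2 : T -> R) :
  measurable_fun setT w1 -> measurable_fun setT w2 ->
  measurable_fun setT (fun x => kern a b c (w1 x) (w2 x)).
Proof.
move=> mw1 mw2; apply: measurable_funM => //; apply: measurableT_comp => //.
apply: measurable_funM => //; apply: measurableT_comp => //.
apply: measurable_funD; last by apply: measurable_funM => //; exact: measurable_funX.
apply: measurable_funB; first by apply: measurable_funM => //; exact: measurable_funX.
by apply: measurable_funM => //; exact: measurable_funM.
Qed.

(** A rank-one update keeps a covariance positive definite: [a] times the new determinant is [a]
    times the old one plus two nonnegative terms. *)
Lemma kern_det_gt0 (a b c t1 t2 : R) : 0 < a -> 0 < a * c - b ^+ 2 ->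
  0 < (a + t1 ^+ 2) * (c + t2 ^+ 2) - (b + t1 * t2) ^+ 2.
Proof.
move=> a0 D0; rewrite -(pmulr_rgt0 _ a0).
rewrite [ltRHS](_ : _ = a * (a * c - b ^+ 2) + (a * t2 - b * t1) ^+ 2 +
   (a * c - b ^+ 2) * t1 ^+ 2); last by ring.
by rewrite -addrA ltr_wpDr ?mulr_gt0// addr_ge0 ?sqr_ge0// mulr_ge0 ?sqr_ge0// ltW.
Qed.

Lemma kern_conv (a b c t1 t2 w1 w2 : R) : 0 < a -> 0 < a * c - b ^+ 2 ->
  (\int[gauss]_x (kern a b c (w1 - t1 * x) (w2 - t2 * x))%:E =
   (kern (a + t1 ^+ 2) (b + t1 * t2) (c + t2 ^+ 2) w1 w2)%:E)%E.
Proof.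
move=> a0 D0; have D'0 := kern_det_gt0 t1 t2 a0 D0.
set D := a * c - b ^+ 2 in D0.
set D' := (a + _) * _ - _ in D'0.
pose B := c * w1 * t1 - b * (w1 * t2 + w2 * t1) + a * w2 * t2.
(* These are the conditional mean and standard deviation of the integrated variable given
   [(w1, w2)]. *)
apply: (@integral_gauss_pdf _ _ (B / D') (Num.sqrt D / Num.sqrt D')).
- by apply: measurable_kern; apply: measurable_funB => //; exact: measurable_funM.
- by move=> x; exact: kern_ge0.
- move=> x.
  have sD0 : 0 < Num.sqrt D by rewrite sqrtr_gt0.
  have sD'0 : 0 < Num.sqrt D' by rewrite sqrtr_gt0.
  rewrite !normal_pdfE ?oner_neq0 ?gt_eqF ?divr_gt0//.
  rewrite /kern -/D -/D' /normal_peak /normal_fun mulrACA [RHS]mulrACA.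
  rewrite -!expRD; congr (_ * expR _).
    rewrite expr1n mul1r -(mulrnAr _ pi) sqrtrM ?sqr_ge0// sqrtr_sqr.
    rewrite ger0_norm ?divr_ge0 ?sqrtr_ge0//; field.
    by rewrite !gt_eqF// sqrtr_gt0 mulrn_wgt0 ?pi_gt0.
  rewrite expr_div_n !sqr_sqrtr ?ltW//.
  have H : D != 0 by rewrite gt_eqF.
  have H' : D' != 0 by rewrite gt_eqF.
  rewrite /D /D' /B in H H' *; field.
  by rewrite H H'.
- exact: kern_ge0.
Qed.

(** Source of the factor 1 / (1 - q) in the second moment: on the diagonal the exponents combine
    into a centered normal density of variance (1 + q) / (1 - q). *)
Lemma integral_kern_diag (q : R) : `|q| < 1 ->
  (\int[gauss]_y (kern 1 q 1 y y * expR (y ^+ 2))%:E = ((1 - q)^-1)%:E)%E.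
Proof.
move=> /ltr_normlP[q1 q2].
have p1 : 0 < 1 - q by rewrite subr_gt0.
have p2 : 0 < 1 + q by lra.
apply: (@integral_gauss_pdf _ _ 0 (Num.sqrt (1 + q) / Num.sqrt (1 - q))).
- apply: measurable_funM; first exact: measurable_kern.
  by apply: measurableT_comp => //; exact: measurable_funX.
- by move=> x; rewrite mulr_ge0 ?kern_ge0 ?expR_ge0.
- move=> x.
  have s1 : 0 < Num.sqrt (1 - q) by rewrite sqrtr_gt0.
  have s2 : 0 < Num.sqrt (1 + q) by rewrite sqrtr_gt0.
  rewrite !normal_pdfE ?oner_neq0 ?gt_eqF ?divr_gt0//.
  rewrite /kern /normal_peak /normal_fun mulr1.
  rewrite [LHS](_ : _ =
    (Num.sqrt (1 - q ^+ 2))^-1 * (Num.sqrt (1 ^+ 2 * pi *+ 2))^-1 *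
    (expR (- (1 * x ^+ 2 - 2 * q * x * x + 1 * x ^+ 2) / (2 * (1 - q ^+ 2))) *
     expR (x ^+ 2) * expR (- (x - 0) ^+ 2 / (1 ^+ 2 *+ 2)))); last by ring.
  rewrite [RHS]mulrA -!expRD; congr (_ * expR _).
    rewrite expr1n mul1r -(mulrnAr _ pi) sqrtrM ?sqr_ge0// sqrtr_sqr.
    rewrite ger0_norm ?divr_ge0 ?sqrtr_ge0//.
    rewrite (_ : 1 - q ^+ 2 = (1 - q) * (1 + q)); last by ring.
    have -> : (1 - q)^-1 = (Num.sqrt (1 - q))^-1 ^+ 2.
      by rewrite exprVn sqr_sqrtr ?ltW.
    rewrite sqrtrM ?ltW//.
    by field; rewrite !gt_eqF// sqrtr_gt0 mulrn_wgt0 ?pi_gt0.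
  rewrite expr_div_n !sqr_sqrtr ?ltW//; field.
  by rewrite !gt_eqF// (_ : 1 - q ^+ 2 = (1 - q) * (1 + q)) ?mulr_gt0//; ring.
- by rewrite invr_ge0 ltW.
Qed.

(** Density of N(m, s^2) relative to N(0, 1). *)
Definition lratio (m s y : R) :=
  s^-1 * expR (y ^+ 2 / 2 - (y - m) ^+ 2 / (2 * s ^+ 2)).

Lemma lratio_ge0 m s y : 0 < s -> 0 <= lratio m s y.
Proof. by move=> s0; rewrite mulr_ge0 ?expR_ge0// invr_ge0 ltW. Qed.

Lemma measurable_lratio d (T : measurableType d) (s : R) (m y : T -> R) :
  measurable_fun setT m -> measurable_fun setT y ->
  measurable_fun setT (fun x => lratio (m x) s (y x)).
Proof.
move=> mm my; apply: measurable_funM => //; apply: measurableT_comp => //.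
apply: measurable_funB; apply: measurable_funM => //; apply: measurable_funX => //.
exact: measurable_funB.
Qed.

Lemma lratio_pdf m s y : 0 < s ->
  lratio m s y * normal_pdf 0 1 y = normal_pdf m s y.
Proof.
move=> s0; rewrite !normal_pdfE ?oner_neq0 ?gt_eqF//.
rewrite /lratio /normal_peak /normal_fun mulrACA -expRD; congr (_ * expR _).
  rewrite expr1n mul1r -(mulrnAr _ pi) sqrtrM ?sqr_ge0// sqrtr_sqr.
  by rewrite gtr0_norm// invfM.
by field; rewrite gt_eqF.
Qed.

(** The factor exp (y^2) comes from dividing twice by the standard normal density at [y]; the rest
    is the kernel with covariance s^2 times the identity. *)
Lemma lratioM m m' s y : 0 < s -> lratio m s y * lratio m' s y =
  kern (s ^+ 2) 0 (s ^+ 2) (y - m) (y - m') * expR (y ^+ 2).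
Proof.
move=> s0; rewrite /lratio /kern mulrACA -[RHS]mulrA -!expRD; congr (_ * expR _).
  rewrite expr0n subr0 -expr2 sqrtr_sqr ger0_norm ?sqr_ge0//.
  by rewrite expr2 invfM.
by field; rewrite gt_eqF.
Qed.

Lemma integral_gauss_affine (m s : R) (f : R -> \bar R) : 0 < s ->
  measurable_fun setT f -> (forall x, 0 <= f x)%E ->
  (\int[gauss]_x f (m + s * x)%R =
   \int[gauss]_y (f y * (lratio m s y)%:E))%E.
Proof.
move=> s0 mf f0; rewrite (ge0_integral_normal_affine m s0 mf f0).
have ml : measurable_fun setT (fun y => f y * (lratio m s y)%:E)%E.
  apply: emeasurable_funM => //; apply/measurable_EFinP.
  by apply: measurable_lratio.
have l0 y : (0 <= f y * (lratio m s y)%:E)%E.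
  by rewrite mule_ge0// lee_fin lratio_ge0.
rewrite (ge0_integral_normal_prob m s mf f0) (ge0_integral_normal_prob 0 1 ml l0).
by apply: eq_integral => y _; rewrite -muleA -EFinM lratio_pdf.
Qed.

End kernel.

(** * Change of measure from the null to a given parameter *)

Section likelihood.
Context {R : realType} (n p : nat).
Local Notation I := ('I_n * 'I_p + 'I_n)%type.
Local Notation T := (coords R I).
Variable Q : probability (coords R I) R.
Hypothesis Q_rect : forall B : I -> set R, (forall i, measurable (B i)) ->
  Q (rectangle B) = (\prod_(i : I) normal_prob 0 1 (B i))%E.
Local Notation gauss := (@normal_prob R 0 1).

(** After [resample], the factor [F] is constant in the inner integral and comes out, so [H] can be
    exchanged for any [H'] with the same one-dimensional integral. *)
Lemma resample_mul (i : I) (F H H' : T -> R) :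
  measurable_fun setT F -> measurable_fun setT H -> measurable_fun setT H' ->
  (forall t, 0 <= F t) -> (forall t, 0 <= H t) -> (forall t, 0 <= H' t) ->
  (forall t x, F (upd t i x) = F t) ->
  (forall t, \int[gauss]_x (H (upd t i x))%:E =
             \int[gauss]_x (H' (upd t i x))%:E)%E ->
  (\int[Q]_t (F t * H t)%:E = \int[Q]_t (F t * H' t)%:E)%E.
Proof.
move=> mF mH mH' F0 H0 H'0 Fi HH'.
have mi t : measurable_fun setT (fun x : R => upd t i x).
  exact: (measurableT_comp (measurable_upd i) (measurable_pair1 t)).
have mFM (G : T -> R) : measurable_fun setT G ->
    measurable_fun setT (fun t => (F t * G t)%:E).
  by move=> mG; apply/measurable_EFinP; exact: measurable_funM.
have FM0 (G : T -> R) : (forall t, 0 <= G t) -> forall t, (0 <= (F t * G t)%:E)%E.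
  by move=> G0 t; rewrite lee_fin mulr_ge0.
rewrite (resample Q_rect i (mFM _ mH) (FM0 _ H0)).
rewrite (resample Q_rect i (mFM _ mH') (FM0 _ H'0)).
apply: eq_integral => t _.
under eq_integral do rewrite Fi EFinM.
under [RHS]eq_integral do rewrite Fi EFinM.
have mE (G : T -> R) : measurable_fun setT G ->
    measurable_fun setT (fun x : R => (G (upd t i x))%:E).
  by move=> mG; apply/measurable_EFinP; exact: (measurableT_comp mG (mi t)).
have gZ (G : T -> R) : measurable_fun setT G -> (forall t, 0 <= G t) ->
    (\int[gauss]_x ((F t)%:E * (G (upd t i x))%:E) =
     (F t)%:E * \int[gauss]_x (G (upd t i x))%:E)%E.
  move=> mG G0; apply: ge0_integralZl => //; first exact: mE.
    by move=> x _; rewrite lee_fin.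
  by rewrite lee_fin.
by rewrite !gZ// HH'.
Qed.

Definition lin (u : 'I_p -> R) (i : 'I_n) (t : T) : R :=
  \sum_(j < p) u j * t (inl (i, j)).

(** Maps the null sample (with variance 1) to the sample of parameter u in the
    observations of D; the sample under P_theta is the case D = predT. *)
Definition shift (u : 'I_p -> R) (s : R) (D : {pred 'I_n}) (t : T) : T :=
  fun x => match x with
    | inl ij => t (inl ij)
    | inr i => if i \in D then lin u i t + s * t (inr i) else t (inr i)
    end.

Lemma measurable_lin u i : measurable_fun setT (lin u i).
Proof.
apply: measurable_sum => j; apply: measurable_funM => //.
exact: measurable_coord.
Qed.

Lemma lin_upd_inr u i i' (t : T) x : lin u i (upd t (inr i') x) = lin u i t.
Proof. by []. Qed.

Lemma lin_upd_inl u i i' j (t : T) x : i != i' ->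
  lin u i (upd t (inl (i', j)) x) = lin u i t.
Proof.
move=> ii'; apply: eq_bigr => j' _; rewrite /upd; case: eqP => // -[ii _].
by rewrite ii eqxx in ii'.
Qed.

Lemma measurable_shift u s D : measurable_fun setT (shift u s D).
Proof.
apply: measurable_fun_coords => -[ij|i] /=; first exact: measurable_coord.
case: (i \in D); last exact: measurable_coord.
apply: measurable_funD; first exact: measurable_lin.
by apply: measurable_funM => //; exact: measurable_coord.
Qed.

Definition lratios (u : 'I_p -> R) (s : R) (r : seq 'I_n) (t : T) : R :=
  \prod_(i <- r) lratio (lin u i t) s (t (inr i)).

Lemma measurable_lratio_lin u s i :
  measurable_fun setT (fun t : T => lratio (lin u i t) s (t (inr i))).
Proof. apply: measurable_lratio; [exact: measurable_lin|exact: measurable_coord]. Qed.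

Lemma measurable_lratios u s r : measurable_fun setT (lratios u s r).
Proof. by apply: measurable_prod => i _; exact: measurable_lratio_lin. Qed.

Lemma lratios_ge0 u s r t : 0 < s -> 0 <= lratios u s r t.
Proof. by move=> s0; apply: prodr_ge0 => i _; exact: lratio_ge0. Qed.

(** Induction on the observations shifted: each new shift moves a single response, and the affine
    change of variable in that coordinate trades it for one likelihood factor. *)
Lemma integral_shift_seq u s (r : seq 'I_n) (f : T -> R) : 0 < s -> uniq r ->
  measurable_fun setT f -> (forall t, 0 <= f t) ->
  (\int[Q]_t (f (shift u s (mem r) t))%:E =
   \int[Q]_t (lratios u s r t * f t)%:E)%E.
Proof.
move=> s0; elim: r f => [|i r IH] f.
  move=> _ _ _; apply: eq_integral => t _; rewrite /lratios big_nil mul1r.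
  by congr (f _)%:E; apply/funext => -[].
move=> /= /andP[ir ur] mf f0.
pose step (t : T) : T := shift u s (pred1 i) t.
have mstep : measurable_fun setT step by exact: measurable_shift.
(* The shifts compose because [lin] reads only covariates, which no shift moves, and [i] is not in
   [r]. *)
transitivity (\int[Q]_t (f (step (shift u s (mem r) t)))%:E)%E.
  apply: eq_integral => t _; congr (f _)%:E; apply/funext => -[//|j].
  rewrite /step /shift /= !inE; have [->|//] := eqVneq j i.
  by rewrite (negbTE ir).
rewrite (IH (fun t => f (step t)))//; last exact: (measurableT_comp mf mstep).
transitivity (\int[Q]_t (lratios u s r t *
    (lratio (lin u i t) s (t (inr i)) * f t))%:E)%E; last first.
  apply: eq_integral => t _; rewrite /lratios big_cons; congr EFin; ring.
apply: (@resample_mul (inr i)) => //.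
- exact: measurable_lratios.
- exact: (measurableT_comp mf mstep).
- apply: measurable_funM => //; exact: measurable_lratio_lin.
- by move=> t; exact: lratios_ge0.
- by move=> t; rewrite mulr_ge0// lratio_ge0.
- move=> t x; apply: eq_big_seq => j jr; rewrite lin_upd_inr; congr lratio.
  by rewrite /upd; case: eqP => // -[ji]; rewrite -ji jr in ir.
move=> t; transitivity (\int[gauss]_x
    (f (upd t (inr i) (lin u i t + s * x)))%:E)%E.
  apply: eq_integral => x _; congr (f _)%:E; apply/funext => -[ij|j].
    by [].
  rewrite /step /shift /= inE /upd.
  have [->|ji] := eqVneq j i; first by rewrite !eqxx.
  by case: eqP => // -[jj]; rewrite jj eqxx in ji.
have mfu : measurable_fun setT (fun x : R => f (upd t (inr i) x)).
  by apply: (measurableT_comp mf);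
    exact: (measurableT_comp (measurable_upd (inr i : I)) (measurable_pair1 t)).
rewrite (@integral_gauss_affine R (lin u i t) s
  (fun x => (f (upd t (inr i) x))%:E) s0)//.
  apply: eq_integral => y _; rewrite lin_upd_inr -EFinM mulrC.
  by rewrite {2}/upd eqxx.
  exact/measurable_EFinP.
by move=> x; rewrite lee_fin.
Qed.

End likelihood.

(** * Inner product of two likelihood ratios under the null *)

Section second_moment.
Context {R : realType} (n p : nat).
Local Notation I := ('I_n * 'I_p + 'I_n)%type.
Local Notation T := (coords R I).
Variable Q : probability (coords R I) R.
Hypothesis Q_rect : forall B : I -> set R, (forall i, measurable (B i)) ->
  Q (rectangle B) = (\prod_(i : I) normal_prob 0 1 (B i))%E.
Local Notation gauss := (@normal_prob R 0 1).
Variables (u u' : 'I_p -> R) (s : R).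
Hypothesis s0 : 0 < s.
Hypothesis us : s ^+ 2 + \sum_(j < p) u j * u j = 1.
Hypothesis us' : s ^+ 2 + \sum_(j < p) u' j * u' j = 1.

Let q := \sum_(j < p) u j * u' j.

(** Covariates are integrated out in increasing order: [low] collects the products of coefficients
    already integrated, [res] removes from the response the contribution of those still present. *)
Let low (v w : 'I_p -> R) (m : nat) := \sum_(j < p | (j < m)%N) v j * w j.

Let res (v : 'I_p -> R) (m : nat) (i : 'I_n) (t : T) :=
  t (inr i) - \sum_(j < p | (m <= j)%N) v j * t (inl (i, j)).

Let sum_lowS (F : 'I_p -> R) (m : 'I_p) :
  \sum_(j < p | (j < m.+1)%N) F j = \sum_(j < p | (j < m)%N) F j + F m.
Proof.
rewrite (bigD1 m)//= addrC; congr (_ + _); apply: eq_bigl => j.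
by rewrite ltnS ltn_neqAle andbC.
Qed.

Let sum_highS (F : 'I_p -> R) (m : 'I_p) :
  \sum_(j < p | (m <= j)%N) F j = F m + \sum_(j < p | (m.+1 <= j)%N) F j.
Proof.
rewrite (bigD1 m)//=; congr (_ + _); apply: eq_bigl => j.
by rewrite [RHS]ltn_neqAle andbC eq_sym.
Qed.

Let lowS (v w : 'I_p -> R) (m : 'I_p) : low v w m.+1 = low v w m + v m * w m.
Proof. exact: sum_lowS. Qed.

Let low_full (v w : 'I_p -> R) : low v w p = \sum_(j < p) v j * w j.
Proof. by apply: eq_bigl => j; rewrite ltn_ord. Qed.

(** Covariance entries of the pair of residuals after [m] steps: s^2 times the identity at [m = 0],
    unit variances and covariance [q] at [m = p]. *)
Let a (m : nat) := s ^+ 2 + low u u m.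
Let b (m : nat) := low u u' m.
Let c (m : nat) := s ^+ 2 + low u' u' m.

Let low0 v w : low v w 0 = 0.
Proof. by rewrite /low big_pred0. Qed.

Let cov_pos (m : nat) : (m <= p)%N -> 0 < a m /\ 0 < a m * c m - b m ^+ 2.
Proof.
elim: m => [_|m IH mp].
  by rewrite /a /b /c !low0 addr0 expr0n subr0; split; rewrite ?mulr_gt0 ?exprn_gt0.
have [a0 D0] := IH (ltnW mp).
have aS : a m.+1 = a m + u (Ordinal mp) ^+ 2.
  by rewrite /a (lowS _ _ (Ordinal mp)) addrA.
have cS : c m.+1 = c m + u' (Ordinal mp) ^+ 2.
  by rewrite /c (lowS _ _ (Ordinal mp)) addrA.
have bS : b m.+1 = b m + u (Ordinal mp) * u' (Ordinal mp).
  by rewrite /b (lowS _ _ (Ordinal mp)).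
rewrite aS bS cS; split; last exact: kern_det_gt0.
by rewrite ltr_wpDr ?sqr_ge0.
Qed.

(** The product of the two likelihood ratios of observation i, once the first m
    covariates are integrated out. *)
Let H (m : nat) (i : 'I_n) (t : T) :=
  kern (a m) (b m) (c m) (res u m i t) (res u' m i t) * expR (t (inr i) ^+ 2).

Let H_ge0 m i t : 0 <= H m i t.
Proof. by rewrite mulr_ge0 ?kern_ge0 ?expR_ge0. Qed.

Let measurable_res v m i : measurable_fun setT (res v m i).
Proof.
apply: measurable_funB; first exact: measurable_coord.
rewrite [X in measurable_fun _ X](_ : _ = (fun t : T =>
    \sum_(j <- [seq j : 'I_p <- enum 'I_p | (m <= j)%N]) v j * t (inl (i, j)))).
  apply: measurable_sum => j; apply: measurable_funM => //.
  exact: measurable_coord.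
by apply/funext => t; rewrite big_filter big_enum_cond.
Qed.

Let measurable_H m i : measurable_fun setT (H m i).
Proof.
apply: measurable_funM; first by apply: measurable_kern; exact: measurable_res.
by apply: measurableT_comp => //; apply: measurable_funX; exact: measurable_coord.
Qed.

Let res_upd v (m : 'I_p) i (t : T) x :
  res v m i (upd t (inl (i, m)) x) = res v m.+1 i t - v m * x.
Proof.
rewrite /res sum_highS {1 2}/upd /= eqxx -addrA -opprD; congr (_ - _).
rewrite addrC; congr (_ + _); apply: eq_bigr => j mj; rewrite /upd.
by case: eqP => // -[jm]; rewrite jm ltnn in mj.
Qed.

Let resS_upd v (m : 'I_p) i (t : T) x :
  res v m.+1 i (upd t (inl (i, m)) x) = res v m.+1 i t.
Proof.
rewrite /res {1}/upd /=; congr (_ - _); apply: eq_bigr => j mj; rewrite /upd.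
by case: eqP => // -[jm]; rewrite jm ltnn in mj.
Qed.

(** Integrating covariate [m] of observation [i] is [kern_conv] in the direction given by the two
    coefficients of that covariate. *)
Let H_step (F : T -> R) (i : 'I_n) (m : 'I_p) :
  measurable_fun setT F -> (forall t, 0 <= F t) ->
  (forall t x, F (upd t (inl (i, m)) x) = F t) ->
  (\int[Q]_t (F t * H m i t)%:E = \int[Q]_t (F t * H m.+1 i t)%:E)%E.
Proof.
move=> mF F0 Fi; apply: (resample_mul Q_rect (i := inl (i, m)) mF
  (measurable_H m i) (measurable_H m.+1 i) F0 (H_ge0 m i) (H_ge0 m.+1 i) Fi) => t.
have [a0 D0] := cov_pos (ltnW (ltn_ord m)).
transitivity (\int[gauss]_x (H m.+1 i t)%:E)%E; last first.
  by apply: eq_integral => x _; rewrite /H !resS_upd.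
rewrite integral_cst// [X in (_ * X)%E](probability_setT gauss) mule1.
transitivity (\int[gauss]_x ((kern (a m) (b m) (c m)
    (res u m.+1 i t - u m * x) (res u' m.+1 i t - u' m * x))%:E *
     (expR (t (inr i) ^+ 2))%:E))%E.
  by apply: eq_integral => x _; rewrite /H !res_upd EFinM.
have mk : measurable_fun setT (fun x : R => (kern (a m) (b m) (c m)
    (res u m.+1 i t - u m * x) (res u' m.+1 i t - u' m * x))%:E).
  apply/measurable_EFinP; apply: measurable_kern; apply: measurable_funB => //;
  exact: measurable_funM.
rewrite [LHS](_ : _ = (\int[gauss]_x (kern (a m) (b m) (c m)
    (res u m.+1 i t - u m * x) (res u' m.+1 i t - u' m * x))%:E *
    (expR (t (inr i) ^+ 2))%:E)%E); last first.
  by apply: ge0_integralZr => // x _; rewrite lee_fin kern_ge0.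
rewrite kern_conv// -EFinM /H; congr ((kern _ _ _ _ _ * _)%:E).
- by rewrite /a lowS addrA expr2.
- by rewrite /b lowS.
- by rewrite /c lowS addrA expr2.
Qed.

(** The determinant after the last step is 1 - q^2, and [cov_pos] makes it positive. *)
Let abs_q : `|q| < 1.
Proof.
have [_] := cov_pos (leqnn p).
rewrite /a /b /c !low_full us us' -/q mulr1 subr_gt0 => q1.
by rewrite -(@ltr_pXn2r _ 2)// ?nnegrE// real_normK ?num_real// expr1n.
Qed.

(** The covariates of observation [i] go first, one by one through [H_step]; the response goes last,
    through [integral_kern_diag]. *)
Lemma integral_lratio_block (F : T -> R) (i : 'I_n) :
  measurable_fun setT F -> (forall t, 0 <= F t) ->
  (forall t x j, F (upd t (inl (i, j)) x) = F t) ->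
  (forall t x, F (upd t (inr i) x) = F t) ->
  (\int[Q]_t (F t * (lratio (lin u i t) s (t (inr i)) *
                     lratio (lin u' i t) s (t (inr i))))%:E =
   ((1 - q)^-1)%:E * \int[Q]_t (F t)%:E)%E.
Proof.
move=> mF F0 Fl Fr.
have q1 : 0 < 1 - q by rewrite subr_gt0; move: abs_q => /ltr_normlP[].
transitivity (\int[Q]_t (F t * H 0 i t)%:E)%E.
  apply: eq_integral => t _; rewrite lratioM//; congr ((_ * (_ * _))%:E).
  rewrite /H /a /b /c !low0 !addr0 /res; congr kern; congr (_ - _);
  by apply: eq_bigl.
have Hm m : (m <= p)%N ->
    (\int[Q]_t (F t * H 0 i t)%:E = \int[Q]_t (F t * H m i t)%:E)%E.
  elim: m => [//|m IH mp]; rewrite (IH (ltnW mp)).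
  exact: (@H_step F i (Ordinal mp) mF F0 (fun t x => Fl t x (Ordinal mp))).
rewrite (Hm p (leqnn p)).
transitivity (\int[Q]_t (F t * (1 - q)^-1)%:E)%E; last first.
  under eq_integral do rewrite mulrC EFinM.
  rewrite ge0_integralZl//.
  - exact/measurable_EFinP.
  - by move=> t _; rewrite lee_fin.
  - by rewrite lee_fin invr_ge0 ltW.
apply: (resample_mul Q_rect (i := inr i)) => //.
- by move=> _; rewrite invr_ge0 ltW.
move=> t; rewrite integral_cst// [X in (_ * X)%E](probability_setT gauss) mule1.
rewrite -(integral_kern_diag abs_q); apply: eq_integral => y _.
rewrite /H /a /b /c !low_full us us' -/q /res.
(* At [m = p] no covariate remains, so both residuals equal the response. *)
by rewrite !big1 ?subr0 /upd ?eqxx// => j; rewrite leqNgt ltn_ord.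
Qed.

Lemma integral_lratiosM :
  (\int[Q]_t (lratios u s (enum 'I_n) t * lratios u' s (enum 'I_n) t)%:E =
   ((1 - q)^-1 ^+ n)%:E)%E.
Proof.
have [q0 q1] : 0 < 1 - q /\ 0 <= (1 - q)^-1.
  have q1 : 0 < 1 - q by rewrite subr_gt0; move: abs_q => /ltr_normlP[].
  by split => //; rewrite invr_ge0 ltW.
pose L (i : 'I_n) (t : T) :=
  lratio (lin u i t) s (t (inr i)) * lratio (lin u' i t) s (t (inr i)).
have mL i : measurable_fun setT (L i).
  by apply: measurable_funM; exact: measurable_lratio_lin.
have L0 i t : 0 <= L i t by rewrite mulr_ge0// lratio_ge0.
have Lr (r : seq 'I_n) : uniq r ->
    (\int[Q]_t (\prod_(i <- r) L i t)%:E = ((1 - q)^-1 ^+ size r)%:E)%E.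
  elim: r => [_|i r IH /= /andP[ir ur]].
    under eq_integral do rewrite big_nil.
    by rewrite integral_cst// [X in (_ * X)%E](probability_setT Q) mule1 expr0.
  under eq_integral do rewrite big_cons mulrC.
  rewrite integral_lratio_block//.
  - by rewrite IH// -EFinM exprS.
  - by apply: measurable_prod => j _; exact: mL.
  - by move=> t; apply: prodr_ge0.
  - move=> t x j; apply: eq_big_seq => j' j'r.
    have ji : j' != i by apply: contraNneq ir => <-.
    by rewrite /L !lin_upd_inl// /upd.
  - move=> t x; apply: eq_big_seq => j' j'r.
    have ji : j' != i by apply: contraNneq ir => <-.
    rewrite /L !lin_upd_inr /upd; case: eqP => // -[jj].
    by rewrite jj eqxx in ji.
rewrite -[in RHS](size_enum_ord n) -Lr ?enum_uniq//.
by apply: eq_integral => t _; rewrite /lratios -big_split.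
Qed.

End second_moment.

(** * Power of a test against a uniform mixture *)

Section testing.
Context {R : realType} (n p : nat).
Local Notation I := ('I_n * 'I_p + 'I_n)%type.
Local Notation T := (coords R I).
Variable Q : probability (coords R I) R.
Hypothesis Q_rect : forall B : I -> set R, (forall i, measurable (B i)) ->
  Q (rectangle B) = (\prod_(i : I) normal_prob 0 1 (B i))%E.

Lemma shift_likelihood u s (A : set T) : 0 < s -> measurable A ->
  (Q (shift u s predT @^-1` A) =
   \int[Q]_t (lratios u s (enum 'I_n) t * \1_A t)%:E)%E.
Proof.
move=> s0 mA; have mS := @measurable_shift R n p u s predT.
have mi : measurable_fun setT (\1_A : T -> R) by exact: measurable_indic.
rewrite -(integral_shift_seq Q_rect u s0 (enum_uniq 'I_n) mi)//.
rewrite -[X in Q X]setIT -integral_indic//; last first.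
  by rewrite -[X in measurable X]setTI; exact: mS.
apply: eq_integral => t _; rewrite !indicE; congr ((nat_of_bool _)%:R%:E).
rewrite (_ : shift u s (mem (enum 'I_n)) t = shift u s predT t).
  by apply/idP/idP; rewrite !inE.
by apply/funext => -[//|i]; rewrite /shift !inE mem_enum.
Qed.

Let intD (f g : T -> R) : measurable_fun setT f -> measurable_fun setT g ->
  (forall t, 0 <= f t) -> (forall t, 0 <= g t) ->
  (\int[Q]_t (f t + g t)%:E = \int[Q]_t (f t)%:E + \int[Q]_t (g t)%:E)%E.
Proof.
move=> mf mg f0 g0; rewrite -ge0_integralD//.
- by move=> t _; rewrite lee_fin.
- by apply/measurable_EFinP.
- by move=> t _; rewrite lee_fin.
- by apply/measurable_EFinP.
Qed.

Let intZ (k : R) (f : T -> R) : measurable_fun setT f ->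
  0 <= k -> (forall t, 0 <= f t) ->
  (\int[Q]_t (k * f t)%:E = k%:E * \int[Q]_t (f t)%:E)%E.
Proof.
move=> mf k0 f0; under eq_integral do rewrite EFinM.
rewrite ge0_integralZl//.
- by apply/measurable_EFinP.
- by move=> t _; rewrite lee_fin.
Qed.

Let int_sum (J : finType) (f : J -> T -> R) :
  (forall j, measurable_fun setT (f j)) -> (forall j t, 0 <= f j t) ->
  (\int[Q]_t (\sum_j f j t)%:E = \sum_j \int[Q]_t (f j t)%:E)%E.
Proof.
move=> mf f0; under eq_integral do rewrite -sumEFin.
rewrite ge0_integral_sum// => j; last by move=> t _; rewrite lee_fin.
exact/measurable_EFinP.
Qed.

Variables (J : finType) (u : J -> 'I_p -> R) (s : R).
Hypothesis J0 : (0 < #|J|)%N.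
Hypothesis s0 : 0 < s.
Hypothesis us : forall j, s ^+ 2 + \sum_(l < p) u j l * u j l = 1.

Let N : R := #|J|%:R.
Let V : R := N^-1 ^+ 2 * \sum_j \sum_j' (1 - \sum_(l < p) u j l * u j' l)^-1 ^+ n.
Let L (t : T) : R := N^-1 * \sum_j lratios (u j) s (enum 'I_n) t.

Let N0 : 0 < N. Proof. by rewrite ltr0n. Qed.
Let NV0 : 0 <= N^-1. Proof. by rewrite invr_ge0 ltW. Qed.

Let L0 t : 0 <= L t.
Proof. by rewrite mulr_ge0// sumr_ge0// => j _; exact: lratios_ge0. Qed.

Let mL : measurable_fun setT L.
Proof.
by apply: measurable_funM => //; apply: measurable_sum => j; exact: measurable_lratios.
Qed.

Let int_LA (A : set T) : measurable A ->
  (\int[Q]_t (L t * \1_A t)%:E =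
   N^-1%:E * \sum_j Q (shift (u j) s predT @^-1` A))%E.
Proof.
move=> mA; under eq_integral do rewrite /L -mulrA big_distrl/=.
have mLA j : measurable_fun setT (fun t => lratios (u j) s (enum 'I_n) t * \1_A t).
  apply: measurable_funM; first exact: measurable_lratios.
  exact: measurable_indic.
have LA0 j t : 0 <= lratios (u j) s (enum 'I_n) t * \1_A t.
  by rewrite mulr_ge0 ?lratios_ge0.
rewrite intZ//; first last.
- by move=> t; apply: sumr_ge0.
- exact: measurable_sum.
congr (_ * _)%E; rewrite int_sum//; apply: eq_bigr => j _.
by rewrite shift_likelihood.
Qed.

Let int_L : (\int[Q]_t (L t)%:E = 1)%E.
Proof.
transitivity (\int[Q]_t (L t * \1_[set: T] t)%:E)%E.
  by apply: eq_integral => t _; rewrite indicT mulr1.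
rewrite int_LA//; under eq_bigr do rewrite preimage_setT probability_setT.
by rewrite sumEFin -EFinM sumr_const mulVf// gt_eqF.
Qed.

Let int_L2 : (\int[Q]_t (L t ^+ 2)%:E = V%:E)%E.
Proof.
transitivity (\int[Q]_t (N^-1 ^+ 2 * \sum_j \sum_j'
    (lratios (u j) s (enum 'I_n) t * lratios (u j') s (enum 'I_n) t))%:E)%E.
  apply: eq_integral => t _; rewrite /L exprMn; congr ((_ * _)%:E).
  by rewrite expr2 big_distrl/=; apply: eq_bigr => j _; rewrite big_distrr.
have mLL j j' : measurable_fun setT
    (fun t => lratios (u j) s (enum 'I_n) t * lratios (u j') s (enum 'I_n) t).
  by apply: measurable_funM; exact: measurable_lratios.
have LL0 j j' t : 0 <= lratios (u j) s (enum 'I_n) t * lratios (u j') s (enum 'I_n) t.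
  by rewrite mulr_ge0 ?lratios_ge0.
rewrite intZ ?sqr_ge0//; first last.
- by move=> t; apply: sumr_ge0 => j _; apply: sumr_ge0.
- by apply: measurable_sum => j; exact: measurable_sum.
rewrite int_sum; first last.
- by move=> j t; apply: sumr_ge0.
- by move=> j; exact: measurable_sum.
rewrite /V [RHS]EFinM; congr (_ * _)%E; rewrite -sumEFin; apply: eq_bigr => j _.
rewrite int_sum// -sumEFin; apply: eq_bigr => j' _.
exact: integral_lratiosM.
Qed.

(** As E L = 1, the mean power exceeds the level by at most E |L - 1| / 2. Bounding |L - 1| by (L -
    1)^2 / (4 eta) + eta leaves only E (L - 1)^2 = V - 1, without a square root. *)
Lemma second_moment_test_bound (A : set T) (alpha eta : R) : measurable A ->
  0 < eta -> (Q A <= alpha%:E)%E ->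
  (N^-1%:E * \sum_j Q (shift (u j) s predT @^-1` A) <=
   (alpha + eta / 2 + (V - 1) / (8 * eta))%:E)%E.
Proof.
move=> mA e0 QA; set x := (X in (X <= _)%E).
have e8 : 0 < (8 * eta)^-1 by rewrite invr_gt0 mulr_gt0.
have e4 : 0 < (4 * eta)^-1 by rewrite invr_gt0 mulr_gt0.
have mi : measurable_fun setT (\1_A : T -> R) by exact: measurable_indic.
have mLA : measurable_fun setT (fun t => L t * \1_A t) by exact: measurable_funM.
have mL2 : measurable_fun setT (fun t => L t ^+ 2) by exact: measurable_funX.
have mZ k (f : T -> R) : measurable_fun setT f -> measurable_fun setT (fun t => k * f t).
  by move=> mf; exact: measurable_funM.
(* 2 |L - 1| <= (L - 1)^2 / (2 eta) + 2 eta, weighted by the sign of 1_A - 1/2 *)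
have ptw t : L t * \1_A t + (2^-1 + (4 * eta)^-1 * L t) <=
    \1_A t + (2^-1 * L t + ((8 * eta)^-1 * L t ^+ 2 + ((8 * eta)^-1 + eta / 2))).
  have e8' := ltW e8; have en0 : eta != 0 by rewrite gt_eqF.
  rewrite -subr_ge0 indicE; case: (t \in A) => /=.
    rewrite [leRHS](_ : _ = (L t - 1 - 2 * eta) ^+ 2 * (8 * eta)^-1); last by field.
    by rewrite mulr_ge0// sqr_ge0.
  rewrite [leRHS](_ : _ = (L t - 1 + 2 * eta) ^+ 2 * (8 * eta)^-1); last by field.
  by rewrite mulr_ge0// sqr_ge0.
(* Only nonnegative terms stand on either side, so both integrals split by additivity for
   nonnegative functions. *)
have : (\int[Q]_t (L t * \1_A t + (2^-1 + (4 * eta)^-1 * L t))%:E <=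
    \int[Q]_t (\1_A t + (2^-1 * L t +
      ((8 * eta)^-1 * L t ^+ 2 + ((8 * eta)^-1 + eta / 2))))%:E)%E.
  apply: ge0_le_integral => //.
  - move=> t _; rewrite lee_fin; apply: addr_ge0; first exact: mulr_ge0.
    by apply: addr_ge0; [by []|apply: mulr_ge0 => //; exact: ltW].
  - apply/measurable_EFinP; apply: measurable_funD => //.
    by apply: measurable_funD => //; exact: mZ.
  - apply/measurable_EFinP; apply: measurable_funD => //.
    by apply: measurable_funD; [exact: mZ|apply: measurable_funD => //; exact: mZ].
  - by move=> t _; rewrite lee_fin.
have h2 : 0 <= 2^-1 :> R by [].
have c0 : 0 <= (8 * eta)^-1 + eta / 2 by rewrite addr_ge0 ?divr_ge0// ltW.
rewrite intD ?int_LA -/x//; first last.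
- by move=> t; apply: addr_ge0; [by []|apply: mulr_ge0 => //; exact: ltW].
- by move=> t; rewrite mulr_ge0.
- by apply: measurable_funD => //; exact: mZ.
rewrite intD//; first last.
- by move=> t; rewrite mulr_ge0// ltW.
- exact: mZ.
rewrite (intZ mL (ltW e4) L0) int_L.
have QT : Q setT = 1%E by exact: probability_setT.
rewrite integral_cst// [X in (_ * X)%E]QT !mule1.
have rhs0 t : 0 <= (8 * eta)^-1 * L t ^+ 2 by rewrite mulr_ge0 ?sqr_ge0// ltW.
rewrite intD//; first last.
- by move=> t; apply: addr_ge0; [exact: mulr_ge0|exact: addr_ge0].
- by apply: measurable_funD; [exact: mZ|apply: measurable_funD => //; exact: mZ].
rewrite integral_indic// setIT.
rewrite intD//; first last.
- by move=> t; rewrite addr_ge0.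
- by move=> t; rewrite mulr_ge0.
- by apply: measurable_funD => //; exact: mZ.
- exact: mZ.
rewrite (intZ mL h2 L0) int_L mule1 intD//; last exact: mZ.
rewrite (intZ mL2 (ltW e8)); last by move=> t; exact: sqr_ge0.
rewrite int_L2 integral_cst// [X in ((_ + _)%:E * X)%E]QT mule1.
move=> h; have {h} := le_trans h (leeD QA (lexx _)).
have e48 : (4 * eta)^-1 = 2 * (8 * eta)^-1 by field; rewrite gt_eqF.
rewrite e48 -!EFinM -!EFinD; case: x => [y| |] //=; last by rewrite !leNye.
by rewrite -EFinD !lee_fin; lra.
Qed.
End testing.

(** * Intersection of a fixed set with a random subset *)

Section random_subset.
Context {R : realFieldType} {T : finType}.

(** Expand the product of (w_i + 1) with w_i = 0 off [B]: only subsets of [B] survive. *)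
Lemma sum_subset_expr (B : {set T}) (w : R) :
  \sum_(S : {set T} | S \subset B) w ^+ #|S| = (1 + w) ^+ #|B|.
Proof.
have -> : (1 + w) ^+ #|B| = \prod_(i : T) ((if i \in B then w else 0) + 1).
  rewrite -prodr_const [LHS]big_mkcond; apply: eq_bigr => i _.
  by case: ifP => _; rewrite ?add0r// addrC.
rewrite bigA_distr [LHS]big_mkcond; apply: eq_bigr => S _; case: ifPn => [SB|].
  rewrite -prodr_const [LHS]big_mkcond; apply: eq_bigr => i _.
  by case: ifP => // /(fintype.subsetP SB) ->.
case/fintype.subsetPn => i iS iB.
by rewrite (bigD1 i)//= iS (negbTE iB) mul0r.
Qed.

(** Removing [S] is injective on its supersets and lands in the subsets of the complement. *)
Lemma card_supsets_le (k : nat) (S : {set T}) :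
  (#|[pred m : {set T} | (S \subset m) && (#|m| == k)]| <=
   'C(#|T| - #|S|, k - #|S|))%N.
Proof.
have -> : (#|T| - #|S|)%N = #|~: S| by rewrite -(cardsC S) addKn.
rewrite -cards_draws.
have inj : {in [pred m : {set T} | (S \subset m) && (#|m| == k)] &,
    injective (fun m => m :\: S)}.
  move=> m m'; rewrite !inE => /andP[Sm _] /andP[Sm' _] mm'.
  rewrite -[LHS](finset.setID m S) -[RHS](finset.setID m' S).
  by rewrite (finset.setIidPr Sm) (finset.setIidPr Sm') mm'.
rewrite -(card_in_imset inj); apply/subset_leq_card/fintype.subsetP => x /imsetP[m].
rewrite inE => /andP[Sm /eqP mk] ->; rewrite cardsD (finset.setIidPr Sm) mk eqxx.
by rewrite andbT finset.setDE finset.subsetIr.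
Qed.

(** Each step multiplies by (k - i) / (p - i), which is at most k / p. *)
Lemma bin_sub_ratio (p k i : nat) : (i <= k)%N -> (k <= p)%N -> (0 < p)%N ->
  'C(p - i, k - i)%:R <= (k%:R / p%:R) ^+ i * 'C(p, k)%:R :> R.
Proof.
move=> ik kp p0; elim: i ik => [_|i IH ik]; first by rewrite !subn0 expr0 mul1r.
have pi0 : (0 < p - i)%N by rewrite subn_gt0 (leq_trans ik).
have pi0' : 0 < (p - i)%:R :> R by rewrite ltr0n.
have p0' : 0 < p%:R :> R by rewrite ltr0n.
have := mul_bin_diag (p - i) (k - i.+1).
rewrite -subnS (subnSK ik) => /(congr1 (fun z : nat => z%:R : R)).
rewrite !natrM => E.
have -> : 'C(p - i.+1, k - i.+1)%:R =
    (k - i)%:R / (p - i)%:R * 'C(p - i, k - i)%:R :> R.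
  apply: (mulfI (lt0r_neq0 pi0')).
  by rewrite E [RHS]mulrA (mulrC (p - i)%:R) divfK// gt_eqF.
rewrite exprS -[leRHS]mulrA; apply: ler_pM; [by []|by []| |exact/IH/ltnW].
rewrite ler_pdivrMr// mulrAC ler_pdivlMr// -!natrM ler_nat.
rewrite mulnBl mulnBr leq_sub2l//.
by rewrite mulnC leq_mul2l kp orbT.
Qed.

(** Domination of a hypergeometric generating function by a binomial one: after expansion over
    subsets [S] of [B], a uniform [k]-set contains [S] with probability at most (k / p)^|S|, where p
    is the size of [T]. *)
Lemma sum_subset_inter_le (k : nat) (B : {set T}) (w : R) :
  0 <= w -> #|B| = k -> (0 < #|T|)%N ->
  \sum_(m : {set T} | #|m| == k) (1 + w) ^+ #|m :&: B| <=
  'C(#|T|, k)%:R * (1 + w * (k%:R / #|T|%:R)) ^+ k.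
Proof.
move=> w0 Bk T0.
have kT : (k <= #|T|)%N by rewrite -Bk max_card.
under eq_bigr do rewrite -sum_subset_expr.
have -> : \sum_(m : {set T} | #|m| == k)
    \sum_(S : {set T} | S \subset m :&: B) w ^+ #|S| =
  \sum_(S : {set T} | S \subset B)
    \sum_(m : {set T} | (S \subset m) && (#|m| == k)) w ^+ #|S|.
  rewrite (exchange_big_dep (fun S : {set T} => S \subset B))/=; last first.
    by move=> m S _; rewrite finset.subsetI => /andP[].
  apply: eq_bigr => S SB; apply: eq_bigl => m.
  by rewrite finset.subsetI SB andbT andbC.
rewrite -[X in _ ^+ X]Bk -sum_subset_expr mulr_sumr; apply: ler_sum => S SB.
have Sk : (#|S| <= k)%N by rewrite -Bk subset_leq_card.
rewrite sumr_const -[leLHS]mulr_natr exprMn [leRHS]mulrC -[leRHS]mulrA.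
rewrite ler_wpM2l ?exprn_ge0//.
apply: le_trans (bin_sub_ratio Sk kT T0); rewrite ler_nat.
exact: card_supsets_le.
Qed.

End random_subset.

(** * Random signs and scalar inequalities *)

Section rademacher.
Context {R : realType}.

Definition sgb (b : bool) : R := (-1) ^+ b.

Lemma sgb_neg b : sgb (~~ b) = - sgb b.
Proof. by case: b; rewrite /sgb /= ?expr0 ?expr1 ?opprK. Qed.

Lemma norm_sgb b : `|sgb b| = 1.
Proof. by rewrite /sgb normrX normrN1 expr1n. Qed.

Lemma sgb_sqr b : sgb b * sgb b = 1.
Proof. by rewrite -expr2 sqrr_sign. Qed.

(** Multiplying by fixed signs preserves uniform independent signs, so each index of [S] contributes
    a factor cosh a. *)
Lemma sum_signs (T : finType) (S : {set T}) (e' : {ffun T -> bool}) (a : R) :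
  \sum_(e : {ffun T -> bool}) expR (a * \sum_(l in S) sgb (e l) * sgb (e' l)) =
  #|{ffun T -> bool}|%:R * ((expR a + expR (- a)) / 2) ^+ #|S|.
Proof.
transitivity (\sum_(e : {ffun T -> bool}) \prod_l
    (if l \in S then expR (a * (sgb (e l) * sgb (e' l))) else 1)).
  by apply: eq_bigr => e _; rewrite mulr_sumr expR_sum big_mkcond.
rewrite -(bigA_distr_bigA (fun l b =>
  if l \in S then expR (a * (sgb b * sgb (e' l))) else 1)).
transitivity (\prod_(l : T) (2 * if l \in S then (expR a + expR (- a)) / 2 else 1)).
  apply: eq_bigr => l _; rewrite big_bool /=; case: ifP => _; last by rewrite mulr1.
  rewrite [RHS]mulrCA mulfV ?pnatr_eq0// mulr1 /sgb.
  by case: (e' l); rewrite !(expr0, expr1) ?(mulrNN, mulr1, mulrN1)// addrC.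
rewrite big_split /= prodr_const card_ffun card_bool natrX; congr (_ * _).
by rewrite -big_mkcond prodr_const.
Qed.

Lemma expR_convex01 (c y : R) : 0 <= c <= 1 -> expR (c * y) <= 1 - c + c * expR y.
Proof.
move=> /andP[c0 c1].
have h1 : expR (c * y) * (1 - c * y) <= 1.
  apply: le_trans (_ : expR (c * y) * expR (- (c * y)) <= _).
    by rewrite ler_wpM2l ?expR_ge0// expR_ge1Dx.
  by rewrite -expRD subrr expR0.
have h2 : expR (c * y) * (1 + (1 - c) * y) <= expR y.
  apply: le_trans (_ : expR (c * y) * expR ((1 - c) * y) <= _).
    by rewrite ler_wpM2l ?expR_ge0// expR_ge1Dx.
  by rewrite -expRD -mulrDl subrKC mul1r.
(* With weights 1 - c and c the linear terms of the two tangent bounds cancel. *)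
have -> : expR (c * y) = (1 - c) * (expR (c * y) * (1 - c * y)) +
    c * (expR (c * y) * (1 + (1 - c) * y)) by ring.
rewrite lerD ?ler_wpM2l// -[leRHS]mulr1 ler_wpM2l// subr_ge0//.
Qed.

(** The left side is (1 + rho2) / (1 + rho2 (1 - t)), at most 1 + rho2 t because the
    cross-multiplied difference is rho2^2 t (1 - t). *)
Lemma inv_affinity_le (rho2 t : R) : 0 <= rho2 -> 0 <= t <= 1 ->
  (1 - rho2 / (1 + rho2) * t)^-1 <= expR (rho2 * t).
Proof.
move=> r0 /andP[t0 t1]; apply: le_trans (expR_ge1Dx _).
have d0 : 0 < 1 + rho2 by rewrite ltr_wpDr.
have d1 : 0 < 1 + rho2 * (1 - t) by rewrite ltr_wpDr// mulr_ge0// subr_ge0.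
have -> : 1 - rho2 / (1 + rho2) * t = (1 + rho2 * (1 - t)) / (1 + rho2).
  by field; rewrite gt_eqF.
rewrite invf_div ler_pdivrMr// -subr_ge0.
rewrite [leRHS](_ : _ = rho2 ^+ 2 * (t * (1 - t))); last by ring.
by rewrite !mulr_ge0 ?sqr_ge0// subr_ge0.
Qed.

(** Of the two opposite arguments, the negative one gives a term at most 1; only the other one needs
    the exponential bound. *)
Lemma inv_affinity_sym_le (rho2 k z : R) (n : nat) : 0 <= rho2 -> 0 < k -> `|z| <= k ->
  (1 - rho2 / (1 + rho2) / k * z)^-1 ^+ n +
  (1 - rho2 / (1 + rho2) / k * (- z))^-1 ^+ n <=
  1 + expR (n%:R * rho2 / k * `|z|).
Proof.
move=> r0 k0 zk.
wlog z0 : z zk / 0 <= z.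
  move=> H; have [/H|/ltW z0] := leP 0 z; first exact.
  have := H (- z); rewrite normrN opprK oppr_ge0 addrC; exact.
rewrite ger0_norm// addrC mulrN opprK in zk *.
have r1 : 0 <= rho2 / (1 + rho2) by rewrite divr_ge0// addr_ge0.
have t01 : 0 <= z / k <= 1 by rewrite divr_ge0 ?(ltW k0)//= ler_pdivrMr// mul1r.
have E : rho2 / (1 + rho2) / k * z = rho2 / (1 + rho2) * (z / k).
  by rewrite -!mulrA [k^-1 * z]mulrC.
have [t0 t1] := andP t01.
have d0 : 0 < 1 + rho2 by rewrite ltr_wpDr.
have rlt : rho2 / (1 + rho2) < 1 by rewrite ltr_pdivrMr// mul1r ltrDr.
rewrite E; apply: lerD.
  apply: exprn_ile1; first by rewrite invr_ge0 addr_ge0// mulr_ge0.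
  have rt0 := mulr_ge0 r1 t0.
  by rewrite invf_le1; [rewrite lerDl|rewrite ltr_wpDr].
have -> : n%:R * rho2 / k * z = n%:R * (rho2 * (z / k)).
  by rewrite -!mulrA [k^-1 * z]mulrC.
rewrite expRM_natl; apply: lerXn2r; rewrite ?nnegrE ?expR_ge0//.
  rewrite invr_ge0 subr_ge0; apply: le_trans (ltW rlt).
  by rewrite ler_piMr.
exact: inv_affinity_le.
Qed.

(** Pointwise form of the concavity of y^c: the bound is its tangent line at y = 2 e = exp (1 + ln
    2), taken at y = exp (a0 z) + exp (- a0 z). Being affine in y, it can be averaged directly. *)
Lemma expR_norm_le (c a a0 z : R) : 0 <= c <= 1 -> a <= c * a0 -> 
  expR (a * `|z|) <= expR (c * (1 + ln 2)) * (1 - c) +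
    expR (c * (1 + ln 2)) * c / (2 * expR 1) * (expR (a0 * z) + expR (- a0 * z)).
Proof.
move=> c01 aca; have [c0 c1] := andP c01.
set M := expR (c * (1 + ln 2)).
have M0 : 0 < M by exact: expR_gt0.
have step : expR (a * `|z|) <= M * expR (c * (a0 * `|z| - (1 + ln 2))).
  by rewrite /M -expRD ler_expR -mulrDr subrKC mulrA ler_wpM2r.
apply: (le_trans step) => {step}.
have -> : M * (1 - c) + M * c / (2 * expR 1) * (expR (a0 * z) + expR (- a0 * z)) =
  M * (1 - c + c * ((expR (a0 * z) + expR (- a0 * z)) / (2 * expR 1))).
  by field; rewrite gt_eqF ?expR_gt0.
rewrite ler_pM2l//; apply: le_trans (expR_convex01 _ c01) _.
rewrite lerD2l ler_wpM2l// expRD expRN expRD lnK ?posrE// [expR 1 * 2]mulrC.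
rewrite ler_wpM2r ?invr_ge0 ?mulr_ge0 ?expR_ge0//.
have [z0|z0] := leP 0 z.
  by rewrite ger0_norm// lerDl expR_ge0.
by rewrite ltr0_norm// mulrN -mulNr lerDr expR_ge0.
Qed.

(** With E = 1 + x + sqrt (2 x), the claim is E^2 - 2 (1 + x) E + 1 <= 0, and the left side equals -
    x^2. This is the origin of the argument of the logarithm in [rho2_kpn]. *)
Lemma cosh_le (x : R) : 0 <= x ->
  (expR (ln (1 + x + Num.sqrt (2 * x))) + expR (- ln (1 + x + Num.sqrt (2 * x)))) / 2
  <= 1 + x.
Proof.
move=> x0; have s0 := sqrtr_ge0 (2 * x).
have ss : Num.sqrt (2 * x) ^+ 2 = 2 * x by rewrite sqr_sqrtr// mulr_ge0.
set s := Num.sqrt _ in s0 ss *.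
have E0 : 0 < 1 + x + s by lra.
rewrite expRN lnK ?posrE// ler_pdivrMr// -(ler_pM2r E0) mulrDl mulVf ?gt_eqF//.
by nra.
Qed.

End rademacher.

(** * Averaging over random supports and signs against a fixed prior point *)

Section prior.
Context {R : realType} (T : finType) (k n : nat).
Hypotheses (k0 : (0 < k)%N) (kT : (k <= #|T|)%N).
Variables (m' : {set T}) (e' : {ffun T -> bool}).
Hypothesis m'k : #|m'| = k.
Local Notation sgb := (@sgb R).

Let x : R := #|T|%:R / k%:R ^+ 2.
Let Z (m : {set T}) (e : {ffun T -> bool}) : R :=
  \sum_(l in m :&: m') sgb (e l) * sgb (e' l).
Let N : R := #|{ffun T -> bool}|%:R.

Let k0' : 0 < k%:R :> R. Proof. by rewrite ltr0n. Qed.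
Let T0 : (0 < #|T|)%N. Proof. exact: leq_trans kT. Qed.
Let T0' : 0 < #|T|%:R :> R. Proof. by rewrite ltr0n. Qed.
Let N0 : 0 <= N. Proof. by rewrite ler0n. Qed.

(** Signs give cosh a to the power |m :&: m'|. The binomial comparison with w = cosh a - 1 <= x then
    gives at most (1 + 1 / k)^k <= e, as x k / p = 1 / k with p the size of [T]. *)
Let sum_expR_le (a : R) : (expR a + expR (- a)) / 2 <= 1 + x ->
  \sum_(m : {set T} | #|m| == k) \sum_e expR (a * Z m e) <=
  'C(#|T|, k)%:R * N * expR 1.
Proof.
set ch := (_ / 2) => chx.
have ch1 : 1 <= ch.
  by rewrite ler_pdivlMr// (le_trans _ (lerD (expR_ge1Dx a) (expR_ge1Dx (- a))))//; lra.
under eq_bigr do rewrite sum_signs -/N -/ch.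
rewrite -mulr_sumr [X in _ <= X * _]mulrC -mulrA ler_wpM2l//.
have w0 : 0 <= ch - 1 by rewrite subr_ge0.
have := sum_subset_inter_le w0 m'k T0; rewrite subrKC => /le_trans; apply.
rewrite ler_wpM2l// -[X in expR X](mulfV (lt0r_neq0 k0')) expRM_natl.
have wk : 0 <= (ch - 1) * (k%:R / #|T|%:R) by rewrite mulr_ge0// divr_ge0.
apply: lerXn2r; rewrite ?nnegrE ?expR_ge0//; first by rewrite addr_ge0.
apply: le_trans (expR_ge1Dx _); rewrite lerD2l.
have -> : k%:R^-1 = x * (k%:R / #|T|%:R) :> R.
  by rewrite /x; field; rewrite !gt_eqF.
by rewrite ler_wpM2r ?divr_ge0// lerBlDl.
Qed.

Let normZ (m : {set T}) e : #|m| == k -> `|Z m e| <= k%:R.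
Proof.
move=> /eqP mk; apply: le_trans (ler_norm_sum _ _ _) _.
under eq_bigr do rewrite normrM !norm_sgb mulr1.
by rewrite sumr_const ler_nat -mk subset_leq_card// finset.subsetIl.
Qed.

Let flip (e : {ffun T -> bool}) : {ffun T -> bool} := [ffun l => ~~ e l].

Let Z_flip (m : {set T}) e : Z m (flip e) = - Z m e.
Proof.
by rewrite /Z -sumrN; apply: eq_bigr => l _; rewrite ffunE sgb_neg mulNr.
Qed.

Let flip_inj : injective flip.
Proof.
move=> e1 e2 /ffunP E; apply/ffunP => l.
by have := E l; rewrite !ffunE => /negb_inj.
Qed.

Lemma prior_moment_le (rho2 c : R) : 0 <= rho2 -> 0 <= c <= 1 ->
  n%:R * rho2 / k%:R <= c * ln (1 + x + Num.sqrt (2 * x)) ->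
  \sum_(m : {set T} | #|m| == k) \sum_e
    (1 - rho2 / (1 + rho2) / k%:R * Z m e)^-1 ^+ n <=
  'C(#|T|, k)%:R * N * ((1 + expR (c * (1 + ln 2))) / 2).
Proof.
move=> r0 c01 ac; set W := (X in X <= _).
pose g (z : R) := (1 - rho2 / (1 + rho2) / k%:R * z)^-1 ^+ n.
set a0 := ln _ in ac; set M := expR (c * (1 + ln 2)).
have x0 : 0 <= x by rewrite divr_ge0.
(* Each sign vector is paired with its opposite, which changes [Z] into its negative. *)
have W2 : W + W = \sum_(m : {set T} | #|m| == k) \sum_e (g (Z m e) + g (- Z m e)).
  rewrite {2}/W -big_split; apply: eq_bigr => m _; rewrite big_split; congr (_ + _).
  rewrite (reindex_inj flip_inj); apply: eq_bigr => e _ /=.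
  by rewrite Z_flip.
pose K := M * c / (2 * expR 1).
have M0 : 0 < M by exact: expR_gt0.
have [c0 c1] := andP c01.
have K0 : 0 <= K by rewrite divr_ge0 ?mulr_ge0 ?expR_ge0// ltW.
(* The constant is kept opaque so that splitting the sums leaves it whole. *)
have [b bE] : exists b, b = 1 + M * (1 - c) by eexists.
have W2le : W + W <= \sum_(m : {set T} | #|m| == k) \sum_(e : {ffun T -> bool})
    (b + (K * expR (a0 * Z m e) + K * expR (- a0 * Z m e))).
  rewrite W2; apply: ler_sum => m mk; apply: ler_sum => e _.
  apply: le_trans (inv_affinity_sym_le n r0 k0' (normZ e mk)) _.
  by rewrite bE -addrA lerD2l -mulrDr; exact: expR_norm_le.
have tot (y : R) : \sum_(m : {set T} | #|m| == k) \sum_(e : {ffun T -> bool}) y =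
    'C(#|T|, k)%:R * N * y.
  have cE : #|[pred m : {set T} | #|m| == k]| = 'C(#|T|, k).
    by rewrite -card_draws; apply: eq_card => m; rewrite !inE.
  transitivity (\sum_(m : {set T} | #|m| == k) (N * y)).
    by apply: eq_bigr => m _; rewrite sumr_const -[LHS]mulr_natl.
  by rewrite sumr_const -[LHS]mulr_natl cE mulrA.
have Ep := sum_expR_le (cosh_le x0).
have Em : \sum_(m : {set T} | #|m| == k) \sum_e expR (- a0 * Z m e) <=
    'C(#|T|, k)%:R * N * expR 1.
  by apply: sum_expR_le; rewrite opprK addrC; exact: cosh_le.
rewrite -/a0 in Ep.
move: W2le.
under eq_bigr do rewrite !big_split -!mulr_sumr.
rewrite !big_split -!mulr_sumr /= tot => W2le.
have KE : K * expR 1 = M * c / 2 by rewrite /K; field; rewrite gt_eqF ?expR_gt0.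
have Kp := ler_wpM2l K0 Ep; have Km := ler_wpM2l K0 Em.
have E2 : K * ('C(#|T|, k)%:R * N * expR 1) = 'C(#|T|, k)%:R * N * (M * c / 2).
  by rewrite mulrCA KE.
rewrite E2 in Kp Km.
have := le_trans W2le (lerD (lexx _) (lerD Kp Km)).
by rewrite bE; lra.
Qed.

End prior.

(** * Numerical lower bound on the radius *)

Section lower_bound.
Context {R : realType}.

(** Here 47 / 100 is 1 - 0.53: the inequality makes the logarithm in the minimum of [rho2_kpn] at
    least 1, hence the minimum at least 1 / 2. *)
Lemma expR1_lt : expR 1 < 1 + 8 * (47 / 100) ^+ 2 :> R.
Proof.
(* The bound (1 - 1/32)^32 <= 1 / e gives e < 2.763, while the target is 2.7672. *)
have h : 31 / 32 <= expR (- (1 / 32)) :> R.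
  by apply: le_trans (expR_ge1Dx _); lra.
have h2 : (31 / 32) ^+ 32 <= expR (- 1) :> R.
  rewrite (_ : - 1 = 32%:R * (- (1 / 32))); last by lra.
  by rewrite expRM_natl lerXn2r// ?nnegrE ?expR_ge0//; lra.
have h3 : expR (- 1) * expR 1 = 1 :> R by rewrite -expRD addNr expR0.
have e0 : 0 < expR 1 :> R := expR_gt0 _.
have h4 : 1 < (31 / 32) ^+ 32 * (1 + 8 * (47 / 100) ^+ 2) :> R by lra.
rewrite -(ltr_pM2l (expR_gt0 (- 1))) h3 (lt_le_trans h4)// ler_wpM2r//.
Qed.

Lemma rho2_kpn_ge (alpha delta : R) (k p n : nat) :
  alpha + delta <= 53 / 100 -> (0 < k)%N -> (0 < n)%N ->
  k%:R / (2 * n%:R) * ln (1 + Num.max (p%:R / k%:R ^+ 2) (Num.sqrt (p%:R / k%:R ^+ 2)))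
    <= rho2_kpn alpha delta k p n.
Proof.
move=> ad k0 n0; rewrite /rho2_kpn.
set x := p%:R / k%:R ^+ 2.
have x0 : 0 <= x by rewrite divr_ge0.
have sx0 := sqrtr_ge0 x.
have ssx : Num.sqrt x <= Num.sqrt (2 * p%:R / k%:R ^+ 2).
  rewrite -mulrA -/x ler_sqrt ?mulr_ge0//; lra.
have c12 : 1 / 2 <= Num.min 1 (ln (1 + 8 * (1 - alpha - delta) ^+ 2) / 2).
  rewrite le_min; apply/andP; split; first by lra.
  rewrite ler_wpM2r ?invr_ge0// -[leLHS](expRK 1) ler_ln ?posrE ?expR_gt0//.
    apply: le_trans (ltW expR1_lt) _; rewrite lerD2l ler_wpM2l//.
    by rewrite lerXn2r ?nnegrE//; lra.
  by rewrite ltr_wpDr// mulr_ge0 ?sqr_ge0.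
have -> : k%:R / (2 * n%:R) = 1 / 2 * (k%:R / n%:R) :> R.
  by field; rewrite pnatr_eq0 -lt0n.
have kn0 : 0 <= k%:R / n%:R :> R by rewrite divr_ge0.
have m0 : 0 <= Num.max x (Num.sqrt x) by rewrite le_max x0.
have ml : Num.max x (Num.sqrt x) <= x + Num.sqrt (2 * p%:R / k%:R ^+ 2).
  by rewrite ge_max; apply/andP; split; lra.
apply: ler_pM.
- by rewrite mulr_ge0.
- by rewrite ln_ge0// lerDl.
- by rewrite ler_wpM2r.
- by rewrite ler_ln ?posrE -?addrA ?lerD2l// ltr_wpDr// (le_trans m0).
Qed.

End lower_bound.

(** * The prior and its second moment *)

Section prior_family.
Context {R : realType} (p k n : nat).
Hypotheses (k0 : (0 < k)%N) (kp : (k <= p)%N).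
Variable rho2 : R.
Hypothesis rho20 : 0 <= rho2.

(** Signs are drawn on all coordinates so that the index set is a product. Those off the support
    only repeat each point equally often, leaving the uniform average unchanged. *)
Definition prior_index := ({m : {set 'I_p} | #|m| == k} * {ffun 'I_p -> bool})%type.

Let r : R := rho2 / (1 + rho2).

(** Scaled so that the squared norm is [r], the value of ||theta||^2 / var(Y) for which ||theta||^2
    / (var(Y) - ||theta||^2) equals [rho2]. *)
Definition prior_point (j : prior_index) (l : 'I_p) : R :=
  Num.sqrt (r / k%:R) * (if l \in val j.1 then sgb (j.2 l) else 0).

Let d0 : 0 < 1 + rho2. Proof. by rewrite ltr_wpDr. Qed.
Let r0 : 0 <= r. Proof. by rewrite divr_ge0// ltW. Qed.
Let k0' : 0 < k%:R :> R. Proof. by rewrite ltr0n. Qed.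

Lemma prior_point_dot (j j' : prior_index) :
  \sum_l prior_point j l * prior_point j' l =
  r / k%:R * \sum_(l in val j.1 :&: val j'.1) sgb (j.2 l) * sgb (j'.2 l).
Proof.
rewrite [in RHS]big_mkcond mulr_sumr; apply: eq_bigr => l _.
rewrite /prior_point mulrACA -expr2 sqr_sqrtr; last exact: divr_ge0 r0 (ltW k0').
congr (_ * _).
rewrite finset.in_setI; case: (l \in val j.1); last by rewrite mul0r.
by case: (l \in val j'.1); rewrite ?mulr0.
Qed.

Lemma prior_point_sqnorm (j : prior_index) :
  \sum_l prior_point j l * prior_point j l = r.
Proof.
rewrite prior_point_dot finset.setIid.
under eq_bigr do rewrite sgb_sqr.
rewrite sumr_const (eqP (valP j.1)) -mulr_natr mul1r divfK// gt_eqF//.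
Qed.

Lemma prior_point_support (j : prior_index) (l : 'I_p) :
  prior_point j l != 0 -> l \in val j.1.
Proof. by rewrite /prior_point; case: ifP => //; rewrite mulr0 eqxx. Qed.

Lemma card_prior_index :
  #|{: prior_index}| = ('C(p, k) * #|{ffun 'I_p -> bool}|)%N.
Proof.
rewrite card_prod card_sub; congr (_ * _)%N.
by rewrite -[in RHS](card_ord p) -card_draws; apply: eq_card => m; rewrite !inE.
Qed.

Lemma card_prior_index_gt0 : (0 < #|{: prior_index}|)%N.
Proof.
by rewrite card_prior_index muln_gt0 bin_gt0 kp card_ffun card_bool expn_gt0.
Qed.

Lemma prior_second_moment_le (c : R) : 0 <= c <= 1 ->
  n%:R * rho2 / k%:R <=
    c * ln (1 + p%:R / k%:R ^+ 2 + Num.sqrt (2 * (p%:R / k%:R ^+ 2))) ->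
  #|{: prior_index}|%:R^-1 ^+ 2 *
    \sum_j \sum_j' (1 - \sum_l prior_point j l * prior_point j' l)^-1 ^+ n <=
  (1 + expR (c * (1 + ln 2))) / 2.
Proof.
move=> c01 ac; set N : R := #|_|%:R; set M := _ / 2.
have N0 : 0 < N by rewrite ltr0n card_prior_index_gt0.
have NE : N = 'C(p, k)%:R * #|{ffun 'I_p -> bool}|%:R.
  by rewrite /N card_prior_index natrM.
suff H : \sum_j \sum_j' (1 - \sum_l prior_point j l * prior_point j' l)^-1 ^+ n <=
    N * (N * M).
  rewrite exprVn ler_pdivrMl ?exprn_gt0//.
  by rewrite expr2 -mulrA.
(* The bound on the sum over [j] is uniform in the second point [j'], so the latter is fixed. *)
rewrite exchange_big /= [leRHS]mulr_natl -sumr_const; apply: ler_sum => j' _.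
have mk' : #|val j'.1| = k by exact/eqP/(valP j'.1).
have kT : (k <= #|'I_p|)%N by rewrite card_ord.
have := @prior_moment_le R 'I_p k n k0 kT (val j'.1) j'.2 mk' rho2 c rho20 c01.
rewrite card_ord => /(_ ac); rewrite -NE; apply: le_trans.
have sub_sum (G : {set 'I_p} -> R) : \sum_(m : {set 'I_p} | #|m| == k) G m =
    \sum_(m : {m : {set 'I_p} | #|m| == k}) G (val m).
  rewrite [LHS](reindex_omap (val : {m : {set 'I_p} | #|m| == k} -> _) insub)
    => [|m mk]; last first.
    by rewrite insubT.
  by apply: eq_bigl => m; rewrite (valP m) valK eqxx.
rewrite sub_sum pair_bigA /=; apply: ler_sum => -[m e] _.
by rewrite prior_point_dot.
Qed.

End prior_family.

(** * From the given random variables to the canonical space *)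

Section realization.
Context {R : realType} d (Omega : measurableType d) (P : probability Omega R).
Variables (n p : nat) (v : R).
Variables (Z : 'I_n -> 'I_p -> Omega -> R) (W : 'I_n -> Omega -> R).
Local Notation I := ('I_n * 'I_p + 'I_n)%type.
Local Notation T := (coords R I).
Hypothesis v0 : 0 < v.

Definition noise (w : Omega) : T :=
  fun x => match x with inl ij => Z ij.1 ij.2 w | inr i => W i w end.

Definition data (t : T) : data_space R n p :=
  ([tuple Num.sqrt v * t (inr i) | i < n],
   [tuple [tuple t (inl (i, j)) | j < p] | i < n]).

Lemma measurable_data : measurable_fun setT data.
Proof.
apply: measurable_fun_pair; apply/measurable_fun_tnthP => i.
  rewrite (_ : _ \o _ = (fun t : T => Num.sqrt v * t (inr i))).
    by apply: measurable_funM => //; exact: measurable_coord.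
  by apply/funext => t /=; rewrite tnth_mktuple.
rewrite (_ : _ \o _ = (fun t : T => [tuple t (inl (i, j)) | j < p])); last first.
  by apply/funext => t /=; rewrite tnth_mktuple.
apply/measurable_fun_tnthP => j.
rewrite (_ : _ \o _ = (fun t : T => t (inl (i, j)))); last first.
  by apply/funext => t /=; rewrite tnth_mktuple.
exact: measurable_coord.
Qed.

(** Responses are homogeneous in sqrt v, so the known variance is factored out and the model reduces
    to var(Y) = 1. *)
Lemma observations_shift (u : 'I_p -> R) (w : Omega) :
  sqnormI u <= 1 ->
  observations v Z W (fun l => Num.sqrt v * u l) w =
  data (shift u (Num.sqrt (1 - sqnormI u)) predT (noise w)).
Proof.
move=> u1; congr (_, _); apply: eq_from_tnth => i; rewrite !tnth_mktuple.
  rewrite /shift /= /lin mulrDr mulr_sumr mulrA; congr (_ + _ * _).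
    by apply: eq_bigr => l _; rewrite mulrA.
  rewrite -sqrtrM ?ltW// mulrBr mulr1; congr (Num.sqrt (_ - _)).
  rewrite /sqnormI mulr_sumr; apply: eq_bigr => l _.
  by rewrite exprMn sqr_sqrtr// ltW.
Qed.

Lemma observations_null (w : Omega) :
  observations v Z W (fun=> 0) w = data (noise w).
Proof.
congr (_, _); apply: eq_from_tnth => i; rewrite !tnth_mktuple.
  rewrite big1 ?add0r => [|l _]; last by rewrite mul0r.
  by rewrite /sqnormI big1 ?subr0// => l _; rewrite expr0n.
Qed.

End realization.

(** * From the average over the prior to the worst parameter *)

Lemma exists_le_average (R : realType) (J : finType) (x : J -> R) (y : R) :
  (0 < #|J|)%N -> (#|J|%:R)^-1 * \sum_j x j <= y -> exists j, x j <= y.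
Proof.
move=> J0 avg; apply: contrapT => /forallNP xy.
have /card_gt0P[j0 _] := J0.
have : \sum_(j : J) y < \sum_j x j.
  apply: ltr_sum => [|j _]; first by apply/hasP; exists j0; rewrite ?mem_index_enum.
  by rewrite ltNge; apply/negP/xy.
rewrite sumr_const -[X in X < _]mulr_natl ltNge -ler_pdivrMl ?ltr0n//.
by rewrite avg.
Qed.

Theorem theorem2 (R : realType) (d : measure_display) (Omega : measurableType d)
    (P : probability Omega R) (n p k : nat) (alpha delta v : R)
    (Z : 'I_n -> 'I_p -> Omega -> R) (W : 'I_n -> Omega -> R) :
  (0 < n)%N -> (1 <= k)%N -> (k <= p)%N ->
  0 < alpha < 1 -> 0 < delta < 1 - alpha -> 0 < v ->
  (forall i j, std_gaussian P (Z i j)) -> (forall i, std_gaussian P (W i)) ->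
  mutually_independent P
    (fun x : ('I_n * 'I_p) + 'I_n =>
       match x with inl ij => Z ij.1 ij.2 | inr i => W i end) ->
  (forall rho : R, 0 <= rho -> rho < Num.sqrt (rho2_kpn alpha delta k p n) ->
     (delta%:E < beta_I P v alpha Z W
        [set theta : 'I_p -> R | Theta_kp k theta /\ (sqnormI theta < v)%R /\
                     (sqnormI theta / (v - sqnormI theta) = rho ^+ 2)%R])%E) /\
  (alpha + delta <= 53 / 100 ->
     k%:R / (2 * n%:R) * ln (1 + Num.max (p%:R / k%:R ^+ 2) (Num.sqrt (p%:R / k%:R ^+ 2)))
       <= rho2_kpn alpha delta k p n).
Proof.
move=> n0 k0 kp a01 /andP[delta0 delta1] v0 gZ gW indep; split; last first.
  by move=> ad; exact: rho2_kpn_ge.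
move=> rho rho0 rho_lt.
have mX : measurable_fun setT (noise Z W).
  apply: measurable_fun_coords => -[ij|i]; last by have [] := gW i.
  by have [] := gZ ij.1 ij.2.
pose mX' := isMeasurableFun.Build _ _ _ _ _ mX.
pose X : {mfun Omega >-> coords R _} := HB.pack (noise Z W) mX'.
pose Q : probability (coords R ('I_n * 'I_p + 'I_n)%type) R := distribution P X.
have Q_rect (B : 'I_n * 'I_p + 'I_n -> set R) : (forall i, measurable (B i)) ->
    Q (rectangle B) = (\prod_i normal_prob 0 1 (B i))%E.
  move=> mB; have := indep B mB.
  rewrite (_ : \bigcap_(i in _) _ = noise Z W @^-1` rectangle B); last first.
    apply/seteqP; split => [w BX [ij|i]|w BX [ij|i] _].
    - exact: (BX (inl ij) Logic.I).
    - exact: (BX (inr i) Logic.I).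
    - exact: (BX (inl ij)).
    - exact: (BX (inr i)).
  move=> E; rewrite /Q /= /distribution /pushforward E; apply: eq_bigr => -[ij|i] _.
    by have [_ ->] := gZ ij.1 ij.2.
  by have [_ ->] := gW i.
set eta := 1 - alpha - delta.
have eta0 : 0 < eta by rewrite /eta; lra.
have e8 : 0 < 8 * eta ^+ 2 by rewrite mulr_gt0// exprn_gt0.
set c := Num.min 1 (ln (1 + 8 * eta ^+ 2) / 2).
have c0 : 0 < c by rewrite lt_min ltr01 divr_gt0// ln_gt0// ltrDl.
have c01 : 0 <= c <= 1 by rewrite (ltW c0) ge_min lexx.
have k0' : 0 < k%:R :> R by rewrite ltr0n.
have n0' : 0 < n%:R :> R by rewrite ltr0n.
have rho2_le : rho ^+ 2 <= rho2_kpn alpha delta k p n.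
  (* As 0 <= rho < sqrt, the root is positive; this excludes its default value 0 at negative
     arguments. *)
  have q0 : 0 < rho2_kpn alpha delta k p n.
    by rewrite -sqrtr_gt0 (le_lt_trans rho0).
  rewrite -[leRHS](sqr_sqrtr (ltW q0)); apply: lerXn2r; rewrite ?nnegrE ?sqrtr_ge0//.
  exact: ltW.
have ac : n%:R * rho ^+ 2 / k%:R <=
    c * ln (1 + p%:R / k%:R ^+ 2 + Num.sqrt (2 * (p%:R / k%:R ^+ 2))).
  rewrite ler_pdivrMr// mulrC -ler_pdivlMr// (le_trans rho2_le)// /rho2_kpn.
  rewrite -/eta -/c [2 * (_ / _)]mulrA le_eqVlt; apply/orP; left; apply/eqP.
  by field; rewrite gt_eqF.
have rho20 : 0 <= rho ^+ 2 by exact: sqr_ge0.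
have d0 : 0 < 1 + rho ^+ 2 by rewrite ltr_wpDr.
set r := rho ^+ 2 / (1 + rho ^+ 2).
have r1E : 1 - r = (1 + rho ^+ 2)^-1 by rewrite /r; field; rewrite gt_eqF.
have r1 : 0 < 1 - r by rewrite r1E invr_gt0.
pose u (j : prior_index p k) := prior_point (rho ^+ 2) j.
have uu j : \sum_l u j l * u j l = r by exact: prior_point_sqnorm.
have sq_u j : sqnormI (u j) = r.
  by rewrite -(uu j); apply: eq_bigr => l _; rewrite expr2.
have s0 : 0 < Num.sqrt (1 - r) by rewrite sqrtr_gt0.
have us j : Num.sqrt (1 - r) ^+ 2 + \sum_l u j l * u j l = 1.
  by rewrite uu sqr_sqrtr ?ltW// subrK.
have V_le := prior_second_moment_le k0 kp rho20 c01 ac.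
set V := (X in X <= _) in V_le.
(* [tau] bounds the mean power of every level-alpha test. Since V - 1 < 4 eta^2, it is below alpha +
   eta = 1 - delta. *)
pose tau := alpha + eta / 2 + (V - 1) / (8 * eta).
have tau_lt : delta < 1 - tau.
  have M_lt : expR (c * (1 + ln 2)) < 1 + 8 * eta ^+ 2.
    (* The gap between 1 + ln 2 and 2 makes the bound strict by a margin independent of the test, so
       strictness survives the infimum. *)
    have ln2 : ln 2 < 1 :> R.
      rewrite -[ltRHS](expRK 1) ltr_ln ?posrE ?expR_gt0//.
      by have := @expR_gt1Dx R 1 (oner_neq0 _); lra.
    apply: (@lt_le_trans _ _ (expR (c * 2))); first by rewrite ltr_expR ltr_pM2l//; lra.
    rewrite -[leRHS]lnK ?posrE ?addr_gt0// ler_expR -ler_pdivlMr//.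
    by rewrite ge_min lexx orbT.
  have : (V - 1) / (8 * eta) < eta / 2.
    rewrite ltr_pdivrMr ?mulr_gt0//.
    have -> : eta / 2 * (8 * eta) = 4 * eta ^+ 2 by field.
    by lra.
  by rewrite /tau /eta; lra.
apply: (@lt_le_trans _ _ (1 - tau)%:E); first by rewrite lte_fin.
apply: le_ereal_inf_tmp => _ /= [A [mA levelA] <-].
have mB : measurable (data v @^-1` A).
  by rewrite -[X in measurable X]setTI; exact: measurable_data.
have QB : (Q (data v @^-1` A) <= alpha%:E)%E.
  move: levelA; rewrite /Ptheta (_ : _ @^-1` A = noise Z W @^-1` (data v @^-1` A))//.
  by apply/funext => w /=; rewrite observations_null.
have J0 := @card_prior_index_gt0 p k kp.
have := second_moment_test_bound Q_rect J0 s0 us mB eta0 QB.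
pose mS j := @measurable_shift R n p (u j) (Num.sqrt (1 - r)) predT.
pose S j := shift (u j) (Num.sqrt (1 - r)) predT @^-1` (data v @^-1` A).
have mSA j : measurable (S j).
  by rewrite -[X in measurable X]setTI; exact: mS.
have fQ j : Q (S j) = (fine (Q (S j)))%:E by rewrite fineK// fin_num_measure.
rewrite -/S; under eq_bigr => j _ do rewrite fQ.
(* Some prior point has power at most [tau], hence type II error at least 1 - tau. *)
rewrite sumEFin -EFinM lee_fin => /(exists_le_average J0)[j Qj].
pose theta l := Num.sqrt v * u j l.
have sq_theta : sqnormI theta = v * r.
  rewrite -(sq_u j) /sqnormI mulr_sumr; apply: eq_bigr => l _.
  by rewrite exprMn sqr_sqrtr// ltW.
have r0 : 0 <= r by rewrite divr_ge0// ltW.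
apply: (@le_trans _ _ (Ptheta P v Z W theta (~` A))); last first.
  apply: ereal_sup_ubound; exists theta => //; split; [|split].
  - rewrite /Theta_kp /= -(eqP (valP j.1)) subset_leq_card//.
    apply/fintype.subsetP => l; rewrite inE /= => thl.
    apply: (@prior_point_support R p k (rho ^+ 2)).
    by apply: contraNneq thl => ul; rewrite /theta /u ul mulr0.
  - by rewrite sq_theta gtr_pMr//; lra.
  - rewrite sq_theta -[X in X - _]mulr1 -mulrBr r1E /r.
    by field; rewrite !gt_eqF.
have -> : Ptheta P v Z W theta (~` A) = Q (~` S j).
  rewrite /Ptheta /Q /= /distribution /pushforward; congr (P _).
  apply/funext => w /=; rewrite observations_shift// sq_u//.
  by apply: ltW; lra.
rewrite probability_setC// fQ -EFinB lee_fin lerD2l lerN2.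
exact: Qj.
Qed.
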